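(* Let $\mathcal{G}=(\mathcal{V},\mathcal{E})$ be a generically $d$-rigid graph on $n$ vertices, let the target configuration $p^*\in\mathbb{R}^{dn}$ be a regular point of the distance map $F$, and let $m^*=F(p^* )$. Then there exists a neighborhood $U$ of $p^*$ such that the node dynamics on $\mathcal{C}$ of the model controller $$\dot p=-\tfrac12R(p)^\dagger\,\Pi(m)\,(m-m^* ),\qquad \dot m=-\Pi(m)(m-m^* ),\qquad m=F(p),$$ and of the gradient controller $$\dot p=-R(p)^\top(R(p)p-m^* )$$ converge exponentially to a configuration congruent to $p^*$ for any initial condition $p\in U$ if and only if $\mathcal{G}$ is $d$-rigid.
   Context: Setting. $\mathcal{G}=(\mathcal{V},\mathcal{E})$ is a finite simple undirected graph with $\mathcal{V}=\{1,\dots,n\}$. A configuration is $p=(p_1,\dots,p_n)\in(\mathbb{R}^d)^n=\mathbb{R}^{dn}$. Two configurations are congruent if they differ by an isometry of $\mathbb{R}^d$ applied to all points. Norms are Euclidean, and $A^\dagger$ is the Moore–Penrose pseudoinverse of $A$. Distance map: $F:\mathbb{R}^{dn}\to\mathbb{R}^{|\mathcal{E}|}$, $F(p)=(\|p_j-p_i\|^2)_{ij\in\mathcal{E}}$. Rigidity matrix: $R(p)\in\mathbb{R}^{|\mathcal{E}|\times dn}$; the row of the edge $ij$ has $(p_i-p_j)^\top$ in the block of columns of vertex $i$, $(p_j-p_i)^\top$ in the block of vertex $j$, and zeros elsewhere. Thus $R(p)p=F(p)$ and $\mathrm{d}F_p=2R(p)$. Regular values and points: let $r=\max_p\mathrm{rk}\,R(p)$.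 $\mathcal{Q}$ is the set of regular values of $F$: the points $m\in\mathrm{Im}\,F$ near which $\mathrm{Im}\,F$ is an embedded smooth submanifold of $\mathbb{R}^{|\mathcal{E}|}$ of dimension $r$ and such that $\mathrm{rk}\,R(p)=r$ for every $p\in F^{-1}(m)$. $\mathcal{C}:=F^{-1}(\mathcal{Q})$ is the set of regular points of $F$. For $m=F(p)\in\mathcal{Q}$, $T_m\mathcal{Q}=\mathrm{Im}\,R(p)$, and $\Pi(m)=R(p)R(p)^\dagger$ is the orthogonal projector of $\mathbb{R}^{|\mathcal{E}|}$ onto $T_m\mathcal{Q}$. Rigidity: $(\mathcal{G},p)$ is locally rigid if there is a neighborhood of $p$ in which every $q$ with $F(q)=F(p)$ is congruent to $p$. $\mathcal{G}$ is $d$-rigid (also called generically $d$-rigid) if $(\mathcal{G},p)$ is locally rigid for every configuration $p$ such that $F(p)$ is a smooth point of the image of $F$; in particular, $(\mathcal{G},p)$ is then locally rigid for every regular $p$. Exponential convergence for initial conditions in $U$ means: there are $K,k>0$ such that for every $p^0\in U$ the solution $p(t)$ with $p(0)=p^0$ exists for all $t\ge0$ and there is a configuration $q$ congruent to $p^*$ with $\|q-p(t)\|\le Ke^{-kt}$ for all $t\ge0$. *)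

(* Defs.v *)
From mathcomp Require Import all_boot all_order all_algebra.
From mathcomp Require Import all_classical all_reals all_analysis.

Set Implicit Arguments.
Unset Strict Implicit.
Unset Printing Implicit Defensive.

Import Order.TTheory GRing.Theory Num.Theory.
Import numFieldNormedType.Exports.

Local Open Scope classical_set_scope.
Local Open Scope ring_scope.

(* The library norm `|x| on matrices is the sup norm; it induces the same
   topology but metric statements below need the Euclidean one. *)
Definition enorm (R : realType) (m n : nat) (A : 'M[R]_(m, n)) : R :=
  Num.sqrt (\sum_i \sum_j A i j ^+ 2).

Definition penrose (R : realType) (m n : nat) (A : 'M[R]_(m, n))
    (B : 'M[R]_(n, m)) : Prop :=
  [/\ A *m B *m A = A, B *m A *m B = B,
      (A *m B)^T = A *m B & (B *m A)^T = B *m A].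

Definition pinv (R : realType) (m n : nat) (A : 'M[R]_(m, n)) : 'M[R]_(n, m) :=
  get [set B | penrose A B].

Lemma gram_unit (R : realType) (m n : nat) (M : 'M[R]_(m, n)) :
  row_free M -> M *m M^T \in unitmx.
Proof.
move=> fM; rewrite -row_free_unit; apply: inj_row_free => x.
rewrite mulmxA => x0.
have /matrixP/(_ 0 0) : (x *m M) *m (x *m M)^T = 0.
  by rewrite trmx_mul mulmxA x0 mul0mx.
rewrite !mxE => s0.
have xM0 : x *m M = 0.
  apply/rowP => j; rewrite [RHS]mxE; apply/eqP; rewrite -sqrf_eq0 expr2.
  move/eqP: s0; rewrite psumr_eq0 => [/allP/(_ j)|i _].
    by rewrite mem_index_enum [X in _ * X]mxE; apply.
  by rewrite [X in _ * X]mxE -expr2 sqr_ge0.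
by apply/eqP; rewrite -(mulmx_free_eq0 x fM) xM0.
Qed.

Lemma penrose_factor (R : realType) (m r n : nat) (C : 'M[R]_(m, r))
    (G : 'M[R]_(r, n)) :
  row_free C^T -> row_free G -> exists B, penrose (C *m G) B.
Proof.
move=> /gram_unit; rewrite trmxK => uC /gram_unit uG.
set g := invmx (G *m G^T); set c := invmx (C^T *m C).
have gT : g^T = g by rewrite /g trmx_inv trmx_mul trmxK.
have cT : c^T = c by rewrite /c trmx_inv trmx_mul trmxK.
pose B := G^T *m g *m c *m C^T.
have AB : C *m G *m B = C *m c *m C^T.
  by rewrite /B !mulmxA -(mulmxA C G) mulmxK.
have BA : B *m (C *m G) = G^T *m g *m G.
  by rewrite /B !mulmxA -(mulmxA _ C^T C) mulmxKV.
exists B; split.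
- by rewrite AB !mulmxA -(mulmxA _ C^T C) mulmxKV.
- by rewrite BA /B !mulmxA -(mulmxA _ G G^T) mulmxKV.
- by rewrite AB !trmx_mul trmxK cT mulmxA.
- by rewrite BA !trmx_mul trmxK gT mulmxA.
Qed.

Lemma penrose_exists (R : realType) (m n : nat) (A : 'M[R]_(m, n)) :
  exists B, penrose A B.
Proof.
rewrite -(mulmx_base A); apply: penrose_factor (row_base_free A).
by rewrite /row_free mxrank_tr; exact: col_base_full.
Qed.

Lemma penrose_unique (R : realType) (m n : nat) (A : 'M[R]_(m, n)) B1 B2 :
  penrose A B1 -> penrose A B2 -> B1 = B2.
Proof.
move=> [a1 b1 c1 d1] [a2 b2 c2 d2].
have AB : A *m B1 = A *m B2.
  by rewrite -c1 -{1}a2 -(mulmxA _ A) trmx_mul c1 c2 mulmxA a1.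
have BA : B1 *m A = B2 *m A.
  by rewrite -d1 -{1}a2 -(mulmxA A) mulmxA trmx_mul d1 d2 -mulmxA (mulmxA A) a1.
by rewrite -b1 BA -mulmxA AB mulmxA b2.
Qed.

Lemma pinvP (R : realType) (m n : nat) (A : 'M[R]_(m, n)) : penrose A (pinv A).
Proof. by have [B AB] := penrose_exists A; exact: getI AB. Qed.

(* A configuration of n points of R^d is the stacked column vector; coordinate
   k of point i sits at index mxvec_index i k. *)
Definition node (R : realType) (n d : nat) (p : 'cV[R]_(n * d)) (i : 'I_n) :
  'rV[R]_d := row i (vec_mx p^T).

Definition congruent (R : realType) (n d : nat) (p q : 'cV[R]_(n * d)) : Prop :=
  exists phi : 'rV[R]_d -> 'rV[R]_d,
    (forall x y, enorm (phi x - phi y) = enorm (x - y)) /\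
    (forall i, node q i = phi (node p i)).

(* The adjacency relation e is meant to be symmetric and irreflexive; an edge
   is represented by its pair of endpoints in increasing order. *)
Definition edges (n : nat) (e : rel 'I_n) : {set 'I_n * 'I_n} :=
  [set ij : 'I_n * 'I_n | (ij.1 < ij.2)%N && e ij.1 ij.2].

Definition edge (n : nat) (e : rel 'I_n) (a : 'I_#|edges e|) : 'I_n * 'I_n :=
  enum_val a.

Definition distmap (R : realType) (n d : nat) (e : rel 'I_n)
    (p : 'cV[R]_(n * d)) : 'cV[R]_#|edges e| :=
  \col_a enorm (node p (edge a).2 - node p (edge a).1) ^+ 2.

Definition rigmx (R : realType) (n d : nat) (e : rel 'I_n)
    (p : 'cV[R]_(n * d)) : 'M[R]_(#|edges e|, n * d) :=
  \matrix_a mxvec (\matrix_v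
    let: (i, j) := edge a in
    if v == i then node p i - node p j
    else if v == j then node p j - node p i
    else 0).

Definition max_rank (R : realType) (n d : nat) (e : rel 'I_n) : nat :=
  \max_(k < #|edges e|.+1 |
          `[< exists p : 'cV[R]_(n * d), \rank (rigmx e p) = k >]) k.

(* f is of class C^k on the open set V: all iterated partial derivatives up to
   order k exist and are continuous there. *)
Fixpoint class_C (R : realType) (N M k : nat) (V : set 'cV[R]_N)
    (f : 'cV[R]_N -> 'cV[R]_M) : Prop :=
  (forall x, V x -> {for x, continuous f}) /\
  if k is k'.+1 then
    forall i : 'I_N,
      (forall x, V x -> derivable f x (delta_mx i 0)) /\
      class_C k' V (fun x => 'D_(delta_mx i 0) f x)
  else True.

Definition smooth_on (R : realType) (N M : nat) (V : set 'cV[R]_N)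
    (f : 'cV[R]_N -> 'cV[R]_M) : Prop := forall k, class_C k V f.

(* Slice chart at m: phi is a diffeomorphism from the open set V onto the open
   set phi(V), with inverse psi, mapping S `&` V onto the part of phi(V) where
   all coordinates of index >= k vanish. *)
Definition submanifold_near (R : realType) (N k : nat) (S : set 'cV[R]_N)
    (m : 'cV[R]_N) : Prop :=
  (k <= N)%N /\
  exists (V : set 'cV[R]_N) (phi psi : 'cV[R]_N -> 'cV[R]_N),
    [/\ open V /\ V m, open (phi @` V),
        smooth_on V phi /\ smooth_on (phi @` V) psi,
        forall x, V x -> psi (phi x) = x &
        forall x, V x -> (S x <-> forall i : 'I_N, (k <= i)%N -> phi x i 0 = 0)].

Definition smooth_point (R : realType) (N : nat) (S : set 'cV[R]_N)
    (m : 'cV[R]_N) : Prop := S m /\ exists k, submanifold_near k S m.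

Definition regular_values (R : realType) (n d : nat) (e : rel 'I_n) :
    set 'cV[R]_#|edges e| :=
  [set m | [/\ range (@distmap R n d e) m,
              submanifold_near (max_rank R d e) (range (@distmap R n d e)) m &
              forall p : 'cV[R]_(n * d), distmap e p = m ->
                \rank (rigmx e p) = max_rank R d e]].

Definition regular_points (R : realType) (n d : nat) (e : rel 'I_n) :
    set 'cV[R]_(n * d) :=
  @distmap R n d e @^-1` @regular_values R n d e.

Definition locally_rigid (R : realType) (n d : nat) (e : rel 'I_n)
    (p : 'cV[R]_(n * d)) : Prop :=
  \forall q \near p, distmap e q = distmap e p -> congruent p q.

Definition d_rigid (R : realType) (n d : nat) (e : rel 'I_n) : Prop :=
  forall p : 'cV[R]_(n * d),
    smooth_point (range (@distmap R n d e)) (distmap e p) -> locally_rigid e p.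

(* The projector Pi(m) for m = F(p). *)
Definition tangent_proj (R : realType) (n d : nat) (e : rel 'I_n)
    (p : 'cV[R]_(n * d)) : 'M[R]_#|edges e| :=
  rigmx e p *m pinv (rigmx e p).

(* x is a solution of x' = v on [0, +oo[; at t = 0 the continuity of x is
   required and the one-sided derivative follows from that of v. *)
Definition has_velocity (R : realType) (N : nat) (x v : R -> 'cV[R]_N) : Prop :=
  {within `[0, +oo[, continuous x} /\
  forall t : R, 0 < t -> is_derive t (1 : R) x (v t).

Definition model_solution (R : realType) (n d : nat) (e : rel 'I_n)
    (mstar : 'cV[R]_#|edges e|) (p0 : 'cV[R]_(n * d))
    (p : R -> 'cV[R]_(n * d)) : Prop :=
  [/\ p 0 = p0,
      forall t : R, 0 <= t -> regular_points e (p t) &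
      exists m : R -> 'cV[R]_#|edges e|,
        [/\ forall t : R, 0 <= t -> m t = distmap e (p t),
            has_velocity p (fun t => - (2%:R^-1 *:
              (pinv (rigmx e (p t)) *m
                (tangent_proj e (p t) *m (m t - mstar))))) &
            has_velocity m (fun t =>
              - (tangent_proj e (p t) *m (m t - mstar)))]].

Definition gradient_solution (R : realType) (n d : nat) (e : rel 'I_n)
    (mstar : 'cV[R]_#|edges e|) (p0 : 'cV[R]_(n * d))
    (p : R -> 'cV[R]_(n * d)) : Prop :=
  [/\ p 0 = p0,
      forall t : R, 0 <= t -> regular_points e (p t) &
      has_velocity p (fun t =>
        - ((rigmx e (p t))^T *m (rigmx e (p t) *m p t - mstar)))].

(* sol p0 p says that p is a solution on [0, +oo[ with p 0 = p0. *)
Definition exp_converges (R : realType) (n d : nat)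
    (sol : 'cV[R]_(n * d) -> (R -> 'cV[R]_(n * d)) -> Prop)
    (pstar : 'cV[R]_(n * d)) (U : set 'cV[R]_(n * d)) : Prop :=
  exists K k : R, [/\ 0 < K, 0 < k &
    forall p0, U p0 ->
      (exists p, sol p0 p) /\
      forall p, sol p0 p ->
        exists2 q, congruent pstar q &
          forall t : R, 0 <= t -> enorm (q - p t) <= K * expR (- (k * t))].

(* Main.v *)
(** Put v = F p - F pstar.  Near pstar the rank of R(p) is constant, so R(p)^+
    is locally bounded and, by Wedin's identity, Lipschitz.  The slice chart at
    F pstar shows that chords of Im F are tangent to Im R(pstar) up to o(|v|),
    hence |v| <= 2 |Pi v| near pstar.  Consequently |v|^2 decays exponentially
    along both fields while the speed is O(|v|), so a trajectory starting close
    to pstar has length O(|v(0)|), never leaves a small ball and converges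
    exponentially to a zero of v, which local rigidity makes congruent to pstar.
    Compactness of the fibres modulo the kernel of R keeps the ball inside the
    regular points; existence of trajectories is Picard iteration for the field
    precomposed with the retraction onto the ball. *)

Require Import Defs.
From HB Require Import structures.
From mathcomp Require Import all_boot all_order all_algebra.
From mathcomp Require Import all_classical all_reals all_analysis.
From mathcomp Require Import ring lra.

Set Implicit Arguments.
Unset Strict Implicit.
Unset Printing Implicit Defensive.

Import Order.TTheory GRing.Theory Num.Theory.
Import numFieldNormedType.Exports.
(* [pinv] also names a partial inverse in mathcomp.classical. *)
Import Defs.

Local Open Scope classical_set_scope.
Local Open Scope ring_scope.

(** * Matrix norms and pseudoinverses *)

(** The obstacle is a graph with more edges than the rank of [R(p)]. There [R(p) R(p)^T] is
    singular, and a residual [v] normal to [Im R(p)] makes both fields vanish without being zero.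
    Such residuals are excluded because [v] is a difference of two points of [Im F], a submanifold
    of dimension exactly [rk R(pstar)] near [F pstar]. The chart enters only to first order, through
    those rows of its differential that cut out the tangent space. All points of the fibre of
    [F pstar] are equilibria, so the limit of a trajectory is not known in advance. Hence the
    argument bounds the length of trajectories instead of their distance to a chosen equilibrium.
    Estimates are made in the sup norm, whose balls are cubes. Sums of squares appear in the
    Lyapunov function, which must be differentiated; passing between the two norms is what puts the
    number of edges into the decay rates. *)

Lemma le_mx_norm (R : realType) (m n : nat) (A : 'M[R]_(m, n)) i j :
  `|A i j| <= `|A|.
Proof.
rewrite [leRHS]/Num.Def.normr /= mx_normrE.
exact: (le_bigmax _ (fun ij : 'I_m * 'I_n => `|A ij.1 ij.2|) (i, j)).
Qed.

Lemma mx_norm_leP (R : realType) (m n : nat) (A : 'M[R]_(m, n)) (c : R) :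
  0 <= c -> (forall i j, `|A i j| <= c) -> `|A| <= c.
Proof.
move=> c0 Ac; rewrite [leLHS]/Num.Def.normr /= mx_normrE.
by apply: bigmax_le => // -[i j] _; exact: Ac.
Qed.

Lemma mx_norm_tr (R : realType) (m n : nat) (A : 'M[R]_(m, n)) : `|A^T| = `|A|.
Proof.
apply/eqP; rewrite eq_le; apply/andP; split; apply: mx_norm_leP => // i j.
  by rewrite mxE le_mx_norm.
by have := le_mx_norm A^T j i; rewrite mxE.
Qed.

Lemma mx_norm_mulmx (R : realType) (m n p : nat) (A : 'M[R]_(m, n))
  (B : 'M[R]_(n, p)) : `|A *m B| <= n%:R * (`|A| * `|B|).
Proof.
apply: mx_norm_leP => [|i j]; first by rewrite !mulr_ge0.
rewrite mxE; apply: (le_trans (ler_norm_sum _ _ _)).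
rewrite mulr_natl -[X in _ *+ X]card_ord -sumr_const.
by apply: ler_sum => k _; rewrite normrM ler_pM // le_mx_norm.
Qed.

Lemma mx_norm_mulmx_le (R : realType) (m n p : nat) (A : 'M[R]_(m, n))
    (B : 'M[R]_(n, p)) (a b : R) :
  `|A| <= a -> `|B| <= b -> `|A *m B| <= n%:R * (a * b).
Proof.
move=> Aa Bb; apply: (le_trans (mx_norm_mulmx A B)).
by rewrite ler_wpM2l // ler_pM.
Qed.

(** Symmetry and idempotence give [P i i] as the sum of squares of row [i]. So
    [P i j ^+ 2 <= P i i], and the case [j = i] forces [P i i <= 1]. *)
Lemma mx_norm_proj (R : realType) (n : nat) (P : 'M[R]_n) :
  P^T = P -> P *m P = P -> `|P| <= 1.
Proof.
move=> PT PP; apply: mx_norm_leP => // i j.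
have Pii k : P k k = \sum_l P k l ^+ 2.
  rewrite -{1}PP mxE; apply: eq_bigr => l _.
  by rewrite -{2}PT mxE expr2.
have sq k l : P k l ^+ 2 <= P k k.
  rewrite Pii (bigD1 l) //= lerDl; apply: sumr_ge0 => *; exact: sqr_ge0.
have P1 : P i i <= 1.
  have := sq i i; have : 0 <= P i i by apply: le_trans (sq i i); exact: sqr_ge0.
  by move=> h0 h1; nra.
rewrite -(@ler_pXn2r _ 2) ?nnegrE // expr1n real_normK ?num_real //.
exact: le_trans (sq i j) P1.
Qed.

Section Pinv.
Variable R : realType.

Lemma pinv_projl (m n : nat) (A : 'M[R]_(m, n)) :
  (A *m pinv A)^T = A *m pinv A /\
  A *m pinv A *m (A *m pinv A) = A *m pinv A.
Proof. by have [a b c d] := @pinvP _ _ _ A; rewrite mulmxA a c. Qed.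

Lemma pinv_projr (m n : nat) (A : 'M[R]_(m, n)) :
  (pinv A *m A)^T = pinv A *m A /\
  pinv A *m A *m (pinv A *m A) = pinv A *m A.
Proof. by have [a b c d] := @pinvP _ _ _ A; rewrite mulmxA b d. Qed.

(** For any generalized inverse [B], [pinv A] equals [(pinv A *m A) *m B *m (A *m pinv A)], with an
    orthogonal projector on either side. It is thus enough to bound one convenient generalized
    inverse. *)
Lemma pinv_le_ginv (m n : nat) (A : 'M[R]_(m, n)) (B : 'M[R]_(n, m)) :
  A *m B *m A = A -> `|pinv A| <= n%:R * (m%:R * `|B|).
Proof.
move=> ABA; have [a b _ _] := @pinvP _ _ _ A.
have -> : pinv A = pinv A *m A *m (B *m (A *m pinv A)).
  by rewrite -{1}b -{2}ABA !mulmxA.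
have [T1 I1] := pinv_projl A; have [T2 I2] := pinv_projr A.
rewrite -[X in _ * X]mul1r; apply: mx_norm_mulmx_le.
  exact: mx_norm_proj.
by rewrite -[X in _ * X]mulr1; apply: mx_norm_mulmx_le => //; exact: mx_norm_proj.
Qed.

(* Wedin's decomposition of the difference of two pseudoinverses. *)
Lemma pinv_sub (m n : nat) (A B : 'M[R]_(m, n)) :
  pinv B - pinv A =
    - (pinv B *m (B - A) *m pinv A)
    + pinv B *m (pinv B)^T *m (B - A)^T *m (1%:M - A *m pinv A)
    + (1%:M - pinv B *m B) *m (B - A)^T *m ((pinv A)^T *m pinv A).
Proof.
have [a1 a2 a3 a4] := @pinvP _ _ _ A; have [b1 b2 b3 b4] := @pinvP _ _ _ B.
have e1 : pinv B *m (pinv B)^T *m B^T = pinv B.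
  by rewrite -mulmxA -trmx_mul b3 mulmxA.
have e2 : A^T *m (1%:M - A *m pinv A) = 0.
  rewrite mulmxBr mulmx1; apply/eqP; rewrite subr_eq0; apply/eqP.
  by rewrite -a3 -trmx_mul a1.
have e3 : A^T *m ((pinv A)^T *m pinv A) = pinv A.
  by rewrite mulmxA -trmx_mul a4.
have e4 : (1%:M - pinv B *m B) *m B^T = 0.
  rewrite mulmxBl mul1mx; apply/eqP; rewrite subr_eq0; apply/eqP.
  by rewrite -b4 -trmx_mul mulmxA b1.
have dT : (B - A)^T = B^T - A^T by rewrite raddfB.
have -> : pinv B *m (pinv B)^T *m (B - A)^T *m (1%:M - A *m pinv A)
    = pinv B *m (1%:M - A *m pinv A).
  by rewrite dT -mulmxA mulmxBl e2 subr0 mulmxA e1.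
have -> : (1%:M - pinv B *m B) *m (B - A)^T *m ((pinv A)^T *m pinv A)
    = - ((1%:M - pinv B *m B) *m pinv A).
  by rewrite dT mulmxBr e4 sub0r mulNmx -mulmxA e3.
rewrite !(mulmxBl, mulmxBr) !mulmx1 !mul1mx !mulmxA.
move: (pinv B *m B *m pinv A) (pinv B *m A *m pinv A) => U V.
by apply/matrixP => i j; rewrite !mxE; ring.
Qed.

(** Each of the three terms of the decomposition contains [B - A] exactly once; the other factors
    are pseudoinverses, bounded by [C], or complementary projectors, bounded by [1 + 1]. The common
    bound [C] does the work of a constant rank assumption, since [pinv] blows up where the rank
    drops. *)
Lemma pinv_lipschitz (m n : nat) (C : R) : 0 <= C -> exists2 K, 0 <= K &
  forall A B : 'M[R]_(m, n), `|pinv A| <= C -> `|pinv B| <= C ->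
    `|pinv B - pinv A| <= K * `|B - A|.
Proof.
move=> C0.
exists (m%:R * (n%:R * (C * 1) * C)
  + m%:R * (n%:R * (m%:R * (C * C) * 1) * (1 + 1))
  + n%:R * (n%:R * ((1 + 1) * 1) * (m%:R * (C * C)))).
  by rewrite !(addr_ge0, mulr_ge0).
move=> A B CA CB; rewrite pinv_sub.
set D := B - A.
have [T1 I1] := pinv_projl A; have [T2 I2] := pinv_projr B.
have q (k : nat) (P : 'M[R]_k) : P^T = P -> P *m P = P -> `|1%:M - P| <= 1 + 1.
  move=> PT PP; apply: (le_trans (ler_normB _ _)); apply: lerD.
    by apply: mx_norm_proj; rewrite ?trmx1 ?mulmx1.
  exact: mx_norm_proj.
have D0 : `|D^T| <= `|D| by rewrite mx_norm_tr.
have CA' : `|(pinv A)^T| <= C by rewrite mx_norm_tr.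
have CB' : `|(pinv B)^T| <= C by rewrite mx_norm_tr.
apply: (le_trans (ler_normD _ _)); rewrite mulrDl; apply: lerD; last first.
  have := mx_norm_mulmx_le (mx_norm_mulmx_le (q _ _ T2 I2) D0)
           (mx_norm_mulmx_le CA' CA).
  by move/le_trans; apply; rewrite le_eqVlt; apply/orP; left; apply/eqP; ring.
apply: (le_trans (ler_normD _ _)); rewrite mulrDl; apply: lerD.
  have := mx_norm_mulmx_le (mx_norm_mulmx_le CB (lexx `|D|)) CA.
  rewrite normrN.
  by move/le_trans; apply; rewrite le_eqVlt; apply/orP; left; apply/eqP; ring.
have := mx_norm_mulmx_le (mx_norm_mulmx_le (mx_norm_mulmx_le CB CB') D0)
           (q _ _ T1 I1).
by move/le_trans; apply; rewrite le_eqVlt; apply/orP; left; apply/eqP; ring.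
Qed.

(** A row [x] with [x *m M = 0] satisfies [x = x *m (1 - M)], hence [|x| <= |x| / 2]. The same
    absorption in [M^-1 = 1 - M^-1 (M - 1)] bounds the inverse. The factor [r] is the price of the
    sup norm, which is not submultiplicative. *)
Lemma near1_unitmx (r : nat) (M : 'M[R]_r) : r%:R * `|M - 1%:M| <= 2^-1 ->
  M \in unitmx /\ `|invmx M| <= 2.
Proof.
move=> h.
have uM : M \in unitmx.
  rewrite -row_free_unit -kermx_eq0; apply/eqP/row_matrixP => i.
  rewrite row0; set x := row i _.
  have xM : x *m M = 0 by rewrite /x -row_mul mulmx_ker row0.
  have : `|x| <= 2^-1 * `|x|.
    have {1}-> : x = x *m (1%:M - M) by rewrite mulmxBr mulmx1 xM subr0.
    apply: (le_trans (mx_norm_mulmx _ _)).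
    by rewrite mulrCA mulrC ler_wpM2r // distrC.
  move=> hx; apply/eqP; rewrite -normr_le0.
  by have := normr_ge0 x; lra.
split=> //.
have : `|invmx M| <= 1 + 2^-1 * `|invmx M|.
  have {1}-> : invmx M = 1%:M - invmx M *m (M - 1%:M).
    by rewrite mulmxBr mulVmx // mulmx1 subKr.
  apply: (le_trans (ler_normB _ _)); apply: lerD.
    by apply: mx_norm_proj; rewrite ?trmx1 ?mulmx1.
  apply: (le_trans (mx_norm_mulmx _ _)).
  by rewrite mulrCA mulrC ler_wpM2r.
by have := normr_ge0 (invmx M); lra.
Qed.

(* Compressing near [A0] to [M = Y A X], with [Y A0 X = 1], gives the
   generalized inverse [X M^-1 Y] of every nearby [A] of the same rank. *)
Lemma pinv_locally_bounded (m n : nat) (A0 : 'M[R]_(m, n)) :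
  exists delta C : R, [/\ 0 < delta, 0 <= C & forall A, `|A - A0| <= delta ->
    (\rank A0 <= \rank A)%N /\ (\rank A = \rank A0 -> `|pinv A| <= C)].
Proof.
set r := \rank A0.
have /row_freeP[X GX] := row_base_free A0.
have /row_fullP[Y YC] := col_base_full A0.
have : Y *m (col_base A0 *m row_base A0) *m X = 1%:M.
  by rewrite mulmxA YC mul1mx GX.
rewrite mulmx_base -/r => YAX.
pose k : R := r%:R * (n%:R * (m%:R * `|Y| * `|X|)).
have k0 : 0 <= k by rewrite !mulr_ge0.
exists ((2 * (k + 1))^-1), (n%:R * (m%:R * (r%:R * (r%:R * (`|X| * 2) * `|Y|)))).
split; first by rewrite invr_gt0 mulr_gt0 // ltr_wpDl.
  by rewrite !mulr_ge0.
move=> A Ad; pose M := Y *m A *m X.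
have /near1_unitmx[uM M2] : r%:R * `|M - 1%:M| <= 2^-1.
  rewrite -YAX /M -mulmxBl -mulmxBr.
  have h := mx_norm_mulmx_le (mx_norm_mulmx_le (lexx `|Y|) Ad) (lexx `|X|).
  apply: (le_trans (ler_wpM2l (ler0n R r) h)).
  have -> : r%:R * (n%:R * (m%:R * (`|Y| * (2 * (k + 1))^-1) * `|X|)) =
     k / (k + 1) / 2.
    by rewrite /k; field; rewrite -/k gt_eqF // ltr_wpDl.
  rewrite -[leRHS]mul1r ler_wpM2r // ler_pdivrMr ?ltr_wpDl //.
  by rewrite mul1r lerDl.
have rAX : \rank (A *m X) = r.
  apply/eqP; rewrite eqn_leq rank_leq_col /=.
  rewrite -{1}(mxrank_unit uM) /M -mulmxA; exact: mxrankM_maxr.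
have rA : (r <= \rank A)%N by rewrite -rAX; exact: mxrankM_maxl.
split=> // rAe.
(* The columns of [A X] lie in the column space of [A]; equality of ranks makes the two spaces
   coincide, so [A] factors through [A X]. *)
have [Z AZ] : exists Z, A = A *m X *m Z.
  suff /submxP[Z hZ] : (A^T <= (A *m X)^T)%MS.
    by exists Z^T; apply: trmx_inj; rewrite trmx_mul trmxK.
  suff : ((A *m X)^T == A^T)%MS by move/andP => [].
  by rewrite -(geq_leqif (mxrank_leqif_eq _)) ?trmx_mul ?submxMl //
    -trmx_mul !mxrank_tr rAX rAe.
apply: (@le_trans _ _ (n%:R * (m%:R * `|X *m invmx M *m Y|))).
  apply: pinv_le_ginv; rewrite {2 3}AZ !mulmxA.
  rewrite -(mulmxA _ Y A) -(mulmxA _ (Y *m A) X) -/M.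
  by rewrite -(mulmxA _ (invmx M)) mulVmx // mulmx1.
do 2![rewrite ler_wpM2l //].
exact: mx_norm_mulmx_le (mx_norm_mulmx_le (lexx _) M2) (lexx _).
Qed.

End Pinv.

(** * Curves and differential equations *)

Lemma is_derive_coord (R : realType) (V : normedModType R) (m n : nat)
    (f : V -> 'M[R]_(m, n)) (x v : V) (l : 'M[R]_(m, n)) i j :
  is_derive x v f l -> is_derive x v (fun y => f y i j) (l i j).
Proof.
move=> [df fl]; split; first exact: (derivable_mxP f x v).1.
by rewrite -fl derive_mx // mxE.
Qed.

Lemma is_derive_mx (R : realType) (V : normedModType R) (m n : nat)
    (f : V -> 'M[R]_(m, n)) (x v : V) (l : 'M[R]_(m, n)) :
  (forall i j, is_derive x v (fun y => f y i j) (l i j)) -> is_derive x v f l.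
Proof.
move=> h; have df : derivable f x v.
  by apply/derivable_mxP => i j; case: (h i j).
split=> //; rewrite derive_mx //; apply/matrixP => i j; rewrite mxE.
by case: (h i j).
Qed.

(** Mean value inequality with a variable speed bound: for every entry, [g + y i j] and [g - y i j]
    have nonnegative derivative. Taking [g] exponential later yields exponential estimates
    directly. *)
Lemma norm_sub_le_derive (R : realType) (m n : nat) (y dy : R -> 'M[R]_(m, n))
    (g dg : R -> R) (a b : R) : a <= b ->
  {within `[a, b], continuous y} -> {within `[a, b], continuous g} ->
  (forall t, a < t < b -> is_derive t 1 y (dy t)) ->
  (forall t, a < t < b -> is_derive t 1 g (dg t)) ->
  (forall t, a < t < b -> `|dy t| <= dg t) ->
  `|y b - y a| <= g b - g a.
Proof.
move=> ab cy cg y' g' le.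
have mono (f df : R -> R) : {within `[a, b], continuous f} ->
    (forall t, a < t < b -> is_derive t 1 f (df t)) ->
    (forall t, a < t < b -> 0 <= df t) -> f a <= f b.
  move=> cf f' df0.
  apply: (@ger0_derive1_ndecr _ f a b) => // t; rewrite in_itv /= => /[dup]abt.
    by move/f' => [].
  by move/f' => [_]; rewrite derive1E => ->; exact: df0.
have cc i j : {within `[a, b], continuous (fun t => y t i j)}.
  apply: (@within_continuous_comp _ _ _ _ y (fun M => M i j)) => //.
  by move=> M _; exact: coord_continuous.
have coord_le t i j : a < t < b -> `|dy t i j| <= dg t.
  by move=> abt; apply: le_trans (le_mx_norm _ _ _) (le t abt).
apply: mx_norm_leP => [|i j].
  rewrite subr_ge0; apply: (mono g dg) => // t abt.
  exact: le_trans (normr_ge0 _) (le t abt).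
rewrite !mxE ler_norml; apply/andP; split.
  suff : g a + y a i j <= g b + y b i j by lra.
  apply: (mono (g + (fun t => y t i j)) (fun t => dg t + dy t i j)).
  - exact: within_continuousD.
  - by move=> t abt; apply: is_deriveD; [exact: g'|exact/is_derive_coord/y'].
  - by move=> t /(coord_le _ i j); rewrite ler_norml => /andP[h _]; lra.
suff : g a - y a i j <= g b - y b i j by lra.
apply: (mono (g - (fun t => y t i j)) (fun t => dg t - dy t i j)).
- exact: within_continuousB.
- by move=> t abt; apply: is_deriveB; [exact: g'|exact/is_derive_coord/y'].
- by move=> t /(coord_le _ i j); rewrite ler_norml => /andP[_ h]; lra.
Qed.

Lemma antiderivative_exists (R : realType) (f : R -> R) : continuous f ->
  exists F : R -> R, F 0 = 0 /\
    forall t : R, 0 <= t -> is_derive t 1 F (f t).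
Proof.
move=> cf.
pose mu := @lebesgue_measure R.
(* Integrating from [-1] makes [0] an interior point, so that the two-sided derivative exists at
   [t = 0] as well. *)
pose F (x : R) := (\int[mu]_(t in `[(-1), x]) f t)%R.
have F' (t : R) : 0 <= t -> is_derive t 1 F (f t).
  move=> t0; have [] := @continuous_FTC1 R f (BLeft (-1)) t (t + 1).
  - by rewrite ltrDl.
  - apply: continuous_compact_integrable; first exact: segment_compact.
    exact: continuous_subspaceT.
  - by rewrite /= lte_fin (lt_le_trans _ t0).
  - exact: cf.
  - by move=> dF <-; split; [exact: dF|rewrite derive1E].
exists (fun t => F t - F 0); rewrite subrr; split=> // t t0.
rewrite -[f t]subr0; apply: (@is_deriveB _ _ _ F (cst (F 0))).
exact: F'.
Qed.

Lemma antiderivative_mx_exists (R : realType) (m n : nat)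
    (f : R -> 'M[R]_(m, n)) : continuous f ->
  exists F : R -> 'M[R]_(m, n), F 0 = 0 /\
    forall t : R, 0 <= t -> is_derive t 1 F (f t).
Proof.
move=> cf.
have cfij i j : continuous (fun t => f t i j).
  move=> t; apply: (@continuous_comp _ _ _ f (fun M => M i j)).
    exact: cf.
  exact: coord_continuous.
have [F HF] := choice (fun ij : 'I_m * 'I_n =>
   @antiderivative_exists R (fun t => f t ij.1 ij.2) (cfij ij.1 ij.2)).
exists (fun t => \matrix_(i, j) F (i, j) t); split.
  by apply/matrixP => i j; rewrite !mxE; case: (HF (i, j)).
move=> t t0; apply: is_derive_mx => i j.
have [_ /(_ t t0)] := HF (i, j).
by under [X in _ -> is_derive _ _ X _]eq_fun do rewrite mxE.
Qed.

(** Entrywise, the intervals of centre [u t] and radius [r t] meet pairwise, so the supremum of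
    their left ends lies in all of them. This form of completeness returns the error bound together
    with the limit, both for the Picard iterates and for a trajectory at large times. *)
Lemma limit_of_radii (R : realType) (T : Type) (m n : nat)
    (u : T -> 'M[R]_(m, n)) (r : T -> R) (t0 : T) :
  (forall s t, `|u s - u t| <= r s + r t) ->
  exists l, forall t, `|l - u t| <= r t.
Proof.
move=> ur.
have r0 t : 0 <= r t by have := ur t t; rewrite subrr normr0; lra.
pose S i j := [set x | exists s, x = u s i j - r s].
have ub i j t : ubound (S i j) (u t i j + r t).
  move=> _ [s ->]; have := le_trans (le_mx_norm _ i j) (ur s t).
  by rewrite !mxE ler_norml => /andP[_ h]; lra.
exists (\matrix_(i, j) sup (S i j)) => t; apply: mx_norm_leP => // i j.
rewrite !mxE ler_norml; apply/andP; split.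
  suff : u t i j - r t <= sup (S i j) by lra.
  by apply: ub_le_sup; [exists (u t i j + r t); exact: ub | exists t].
suff : sup (S i j) <= u t i j + r t by lra.
apply: ge_sup; last exact: ub.
by exists (u t0 i j - r t0); exists t0.
Qed.

(** Takes the place of a passage to the limit: equalities between limits of the iterates are proved
    by bounding their distance by a multiple of [2^-n] for every [n]. *)
Lemma le0_of_le_geometric (R : realType) (x c : R) :
  (forall n, x <= c * 2^-1 ^+ n) -> x <= 0.
Proof.
move=> h; rewrite leNgt; apply/negP => x0.
have := @upper_nthrootP R (c / x) _ (leqnn _).
set N := Num.Def.archi_bound _ => cN; have := h N.
have e : (2 : R) ^+ N * 2^-1 ^+ N = 1 by rewrite -exprMn divff // expr1n.
have p2 : (0 : R) < 2^-1 ^+ N by rewrite exprn_gt0.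
rewrite ltr_pdivrMr // in cN; rewrite leNgt => /negP; apply.
by rewrite -[ltRHS]mul1r -[X in X * x]e mulrAC ltr_pM2r.
Qed.

Lemma is_derive_expM (R : realType) (a c : R) (t : R) :
  is_derive t 1 (fun s : R => c * expR (a * s)) (a * c * expR (a * t)).
Proof.
have h : is_derive t 1 (fun s : R => a * s) a.
  by rewrite -[X in is_derive _ _ _ X]mulr1; exact: is_deriveZ.
have := is_deriveZ c (is_derive1_comp (is_derive_expR (a * t)) h).
move=> h'; apply: is_derive_eq h' _.
by rewrite /GRing.scale /=; ring.
Qed.

Lemma continuous_expM (R : realType) (a c : R) :
  continuous (fun s : R => c * expR (a * s)).
Proof.
move=> t; apply/differentiable_continuous/derivable1_diffP.
by case: (is_derive_expM a c t).
Qed.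

Lemma lipschitz_at_continuous (R : realType) (V W : normedModType R)
    (f : V -> W) (x : V) (L : R) :
  (forall y, `|x - y| <= 1 -> `|f x - f y| <= L * `|x - y|) ->
  {for x, continuous f}.
Proof.
move=> fL; apply/cvgrPdist_le => /= eps e0.
have M0 : 0 < `|L| + 1 by rewrite ltr_wpDl.
near=> y; have xy : `|x - y| <= 1.
  by near: y; apply: cvgr_dist_le; [exact: cvg_id|].
apply: (le_trans (fL y xy)).
apply: (@le_trans _ _ ((`|L| + 1) * `|x - y|)).
  by rewrite ler_wpM2r // ler_wpDr // ler_norm.
rewrite mulrC -ler_pdivlMr //.
near: y; apply: cvgr_dist_le; last exact: divr_gt0.
exact: cvg_id.
Unshelve. all: by end_near. Qed.

Lemma lipschitz_continuous (R : realType) (V W : normedModType R) (f : V -> W)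
    (L : R) : (forall x y, `|f x - f y| <= L * `|x - y|) -> continuous f.
Proof. by move=> fL x; apply: lipschitz_at_continuous (fun y _ => fL x y). Qed.

Lemma maxr_lipschitz (R : realType) (a s t : R) :
  `|Num.max s a - Num.max t a| <= `|s - t|.
Proof.
by case: (leP s a) => hs; case: (leP t a) => ht;
  rewrite ?subrr ?normr0 // ler_norml; have := ler_norm (s - t);
  have := ler_norm (t - s); rewrite (distrC t s) => *; lra.
Qed.

Lemma minr_lipschitz (R : realType) (a s t : R) :
  `|Num.min s a - Num.min t a| <= `|s - t|.
Proof.
by case: (leP s a) => hs; case: (leP t a) => ht;
  rewrite ?subrr ?normr0 // ler_norml; have := ler_norm (s - t);
  have := ler_norm (t - s); rewrite (distrC t s) => *; lra.
Qed.

(** * Picard iteration for a bounded, globally Lipschitz field *)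

Section Picard.
Variables (R : realType) (N : nat) (Y : 'cV[R]_N -> 'cV[R]_N) (L M : R).
Hypothesis L0 : 0 < L.
Hypothesis YL : forall x z, `|Y x - Y z| <= L * `|x - z|.
Hypothesis YM : forall x, `|Y x| <= M.
Variable x0 : 'cV[R]_N.

Let good (y : R -> 'cV[R]_N) :=
  y 0 = x0 /\ forall s t : R, `|y s - y t| <= M * `|s - t|.

Let goodC y : good y -> continuous y.
Proof. by move=> [_ h]; exact: (@lipschitz_continuous _ _ _ _ M). Qed.

Let integral_step y : good y -> exists z, good z /\
  (forall t : R, 0 < t -> is_derive t 1 z (Y (y t))).
Proof.
move=> gy; have cYy : continuous (Y \o y).
  move=> t; apply: continuous_comp; first exact: goodC.
  exact: (@lipschitz_continuous _ _ _ _ L).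
have [F [F0 F']] := antiderivative_mx_exists cYy.
(* The curve is frozen at negative times, where the derivative of [F] is not known; this makes it
   Lipschitz on the whole line. *)
exists (fun t => x0 + F (Num.max t 0)); split.
  split; first by rewrite maxxx F0 addr0.
  move=> s t; rewrite opprD addrACA subrr add0r.
  have M0 : 0 <= M by apply: le_trans (normr_ge0 _) (YM x0).
  apply: (@le_trans _ _ (M * `|Num.max s 0 - Num.max t 0|)); last first.
    by rewrite ler_wpM2l // maxr_lipschitz.
  have : 0 <= Num.max s 0 by rewrite le_max lexx orbT.
  have : 0 <= Num.max t 0 by rewrite le_max lexx orbT.
  move: (Num.max s 0) (Num.max t 0) => {}s {}t t0 s0.
  have H a b : 0 <= a -> a <= b -> `|F b - F a| <= M * (b - a).
    move=> a0 ab; rewrite mulrBr.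
    apply: (@norm_sub_le_derive _ _ _ F (Y \o y) ( *%R M) (cst M)) => //.
    - apply: derivable_within_continuous => z; rewrite in_itv /= => /andP[az _].
      by case: (F' z (le_trans a0 az)).
    - apply: continuous_subspaceT => z; exact: mulrl_continuous.
    - by move=> z /andP[az _]; apply: F'; rewrite (le_trans a0) // ltW.
    - move=> z _; rewrite -[X in is_derive _ _ _ X]mulr1; exact: is_deriveZ.
    - by move=> z _ /=; exact: YM.
  have [ts|/ltW st] := leP t s.
    by rewrite (ger0_norm (_ : 0 <= s - t)) ?H // subr_ge0.
  by rewrite distrC (distrC s) (ger0_norm (_ : 0 <= t - s)) ?H // subr_ge0.
move=> t t0; apply: near_eq_is_derive.
  near=> s; have s0 : 0 < s by near: s; exact: lt_nbhsr.
  rewrite (max_l (ltW s0)); reflexivity.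
rewrite -[Y (y t)]add0r; apply: (@is_deriveD _ _ _ (cst x0)).
by apply: F'; exact: ltW.
Unshelve. all: by end_near. Qed.

(* With the weight e^(2Lt), one integration step halves distances. *)
Let integral_step_contracts (y1 y2 z1 z2 : R -> 'cV[R]_N) (c : R) :
  good z1 -> good z2 ->
  (forall t : R, 0 < t -> is_derive t 1 z1 (Y (y1 t))) ->
  (forall t : R, 0 < t -> is_derive t 1 z2 (Y (y2 t))) ->
  (forall t : R, 0 <= t -> `|y1 t - y2 t| <= c * expR (2 * L * t)) ->
  forall t : R, 0 <= t -> `|z1 t - z2 t| <= c * 2^-1 * expR (2 * L * t).
Proof.
move=> g1 g2 d1 d2 h t t0.
have c0 : 0 <= c.
  by have := le_trans (normr_ge0 _) (h 0 (lexx _)); rewrite mulr0 expR0 mulr1.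
pose g s : R := c * 2^-1 * expR (2 * L * s).
have := @norm_sub_le_derive _ _ _ (z1 - z2) (fun t => Y (y1 t) - Y (y2 t))
  g (fun s => 2 * L * (c * 2^-1) * expR (2 * L * s)) 0 t t0.
rewrite /= -![(_ - _ : _ -> _) _]/(_ - _) g1.1 g2.1 subrr subr0 => H.
apply: (@le_trans _ _ (g t - g 0)); last first.
  by rewrite gerBl /g mulr_ge0 ?expR_ge0 // mulr_ge0.
apply: H.
- by apply: within_continuousB; apply: continuous_subspaceT; exact: goodC.
- by apply: continuous_subspaceT; exact: continuous_expM.
- by move=> s /andP[s0 _]; apply: is_deriveB; [exact: d1|exact: d2].
- by move=> s _; exact: is_derive_expM.
- move=> s /andP[/ltW s0 _]; apply: (le_trans (YL _ _)).
  have -> : 2 * L * (c * 2^-1) * expR (2 * L * s) = L * (c * expR (2 * L * s)).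
    by field.
  by rewrite ler_pM2l // h.
Qed.

Lemma picard_exists : exists y : R -> 'cV[R]_N, [/\ y 0 = x0, continuous y &
  forall t : R, 0 < t -> is_derive t 1 y (Y (y t))].
Proof.
have step y : exists z, good y -> good z /\
    (forall t : R, 0 < t -> is_derive t 1 z (Y (y t))).
  have [gy|ngy] := pselect (good y).
    by have [z] := integral_step gy; exists z.
  by exists y => /ngy.
have [S HS] := choice step.
have M0 : 0 <= M by apply: le_trans (normr_ge0 _) (YM x0).
pose u k := iter k S (cst x0).
have gu k : good (u k).
  elim: k => [|k IH] /=; last by case: (HS _ IH).
  by split=> // s t; rewrite subrr normr0 mulr_ge0.
have du k (t : R) : 0 < t -> is_derive t 1 (u k.+1) (Y (u k t)).
  by case: (HS _ (gu k)) => _; apply.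
(* Chosen for the first iterate: [|u 1 t - u 0 t| <= M t], and [L t <= e^(2Lt)] turns this into
   [c e^(2Lt)]. *)
pose c := M / L.
have c0 : 0 <= c by rewrite divr_ge0 // ltW.
have e1 (t : R) : 0 <= t -> L * t <= expR (2 * L * t).
  move=> t0; have := expR_ge1Dx (2 * L * t).
  have : 0 <= L * t by rewrite mulr_ge0 // ltW.
  by lra.
have cu k (t : R) : 0 <= t ->
    `|u k.+1 t - u k t| <= c * 2^-1 ^+ k * expR (2 * L * t).
  elim: k t => [|k IH] t t0.
    rewrite expr0 mulr1 /= -{2}(gu 1%N).1.
    apply: (le_trans ((gu 1%N).2 _ _)); rewrite subr0 ger0_norm //.
    rewrite /c -mulrA ler_wpM2l // -(ler_pM2l L0).
    by rewrite mulrA mulfV ?gt_eqF // mul1r e1.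
  rewrite exprSr mulrA.
  by apply: (integral_step_contracts (gu _) (gu _) (du _) (du _) IH).
(* Writing the partial geometric sum as a difference lets the induction on [l] telescope; dropping
   the last term leaves the radius [r]. *)
have cu2 k l (t : R) : 0 <= t -> `|u (l + k)%N t - u k t| <=
    2 * c * expR (2 * L * t) * (2^-1 ^+ k - 2^-1 ^+ (l + k)).
  move=> t0; elim: l => [|l IH]; first by rewrite !subrr normr0 mulr0.
  have -> : u (l.+1 + k)%N t - u k t =
      (u (l + k).+1 t - u (l + k)%N t) + (u (l + k)%N t - u k t).
    by rewrite addrA subrK.
  apply: (le_trans (ler_normD _ _)).
  apply: (le_trans (lerD (cu _ _ t0) IH)).
  rewrite le_eqVlt; apply/orP; left; apply/eqP.
  by rewrite addSn exprS; field.
pose r (t : R) k := 2 * c * expR (2 * L * t) * 2^-1 ^+ k.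
have E0 (t : R) : 0 <= 2 * c * expR (2 * L * t).
  by rewrite mulr_ge0 ?expR_ge0 // mulr_ge0.
have half0 k : 0 <= (2^-1 : R) ^+ k by rewrite exprn_ge0.
have lim (t : R) : 0 <= t -> exists l, forall k, `|l - u k t| <= r t k.
  move=> t0; apply: (limit_of_radii 0%N) => k l.
  wlog kl : k l / (k <= l)%N.
    move=> H; case: (leqP k l) => [|/ltnW] /H; first by [].
    by rewrite distrC [X in _ <= X]addrC.
  rewrite distrC -(subnK kl); apply: (le_trans (cu2 _ _ _ t0)).
  rewrite mulrBr subnK // /r lerD2l.
  by apply: (@le_trans _ _ 0); rewrite ?oppr_le0 mulr_ge0.
have lim' (t : R) : exists l, forall k,
    `|l - u k (Num.max t 0)| <= r (Num.max t 0) k.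
  by apply: lim; rewrite le_max lexx orbT.
have [y Hy] := choice lim'.
have yl k (t : R) : 0 <= t -> `|y t - u k t| <= r t k.
  by move=> t0; have := Hy t k; rewrite (max_l t0).
(* [choice] picks the values at [t] and at [Num.max t 0] independently, but both are limits of the
   same sequence. *)
have ymax (t : R) : y t = y (Num.max t 0).
  apply/eqP; rewrite -subr_eq0 -normr_le0; set t' := Num.max t 0.
  have t'0 : 0 <= t' by rewrite /t' le_max lexx orbT.
  apply: (@le0_of_le_geometric _ _ (2 * (2 * c * expR (2 * L * t')))) => k.
  have -> : y t - y t' = (y t - u k t') - (y t' - u k t').
    by rewrite opprB addrA subrK.
  apply: (le_trans (ler_normB _ _)); rewrite -mulrA mulr_natl mulr2n.
  by apply: lerD; [exact: Hy | exact: yl].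
have gy : good y.
  split.
    apply/eqP; rewrite -subr_eq0 -normr_le0.
    apply: (@le0_of_le_geometric _ _ (2 * c * expR (2 * L * 0))) => k.
    by rewrite -(gu k).1; exact: yl.
  have lip (s t : R) : 0 <= s -> 0 <= t -> `|y s - y t| <= M * `|s - t|.
    move=> s0 t0; rewrite -subr_le0.
    apply: (@le0_of_le_geometric _ _ (2 * c * expR (2 * L * s)
      + 2 * c * expR (2 * L * t))) => k.
    rewrite lerBlDr mulrDl addrAC; have := (gu k).2 s t.
    have -> : y s - y t = (y s - u k s) + (u k s - u k t) - (y t - u k t).
      by rewrite subrKA opprB addrA subrK.
    have := yl k s s0; have := yl k t t0; rewrite /r => h1 h2 h3.
    apply: (le_trans (ler_normB _ _)).
    apply: lerD => //; apply: (le_trans (ler_normD _ _)); exact: lerD.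
  move=> s t; rewrite (ymax s) (ymax t).
  apply: (le_trans (lip _ _ _ _)); rewrite ?le_max ?lexx ?orbT //.
  by rewrite ler_wpM2l // maxr_lipschitz.
have [gz dz] := HS _ gy.
(* [y] is a fixed point of the integration step: [S y] is as close to [u k.+1] as contraction makes
   it, and so is [y]. *)
have zy (t : R) : 0 <= t -> S y t = y t.
  move=> t0; apply/eqP; rewrite -subr_eq0 -normr_le0.
  apply: (@le0_of_le_geometric _ _ (2 * c * expR (2 * L * t))) => k.
  have -> : S y t - y t = (S y t - u k.+1 t) - (y t - u k.+1 t).
    by rewrite opprB addrA subrK.
  apply: (le_trans (ler_normB _ _)).
  have h1 := integral_step_contracts gz (gu k.+1) dz (du k)
      (c := 2 * c * 2^-1 ^+ k) _ t0.
  have h2 := yl k.+1 t t0.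
  apply: (le_trans (lerD (h1 _) h2)).
    by move=> s s0; apply: (le_trans (yl k s s0)); rewrite /r mulrAC.
  rewrite le_eqVlt; apply/orP; left; apply/eqP.
  by rewrite /r exprS; field.
exists (S y); split; [by case: gz | exact: goodC | ].
by move=> t t0; rewrite zy ?ltW //; exact: dz.
Qed.
End Picard.

Lemma within_continuous_dist (R : realType) (V : normedModType R) (A : set R)
    (f : R -> V) (s eps : R) : {within A, continuous f} -> A s -> 0 < eps ->
  exists2 eta : R, 0 < eta & forall t, A t -> `|s - t| < eta -> `|f s - f t| < eps.
Proof.
move=> cf As e0; have /cvgrPdist_lt/(_ _ e0) := cf s.
rewrite /prop_near1 /nbhs /= -nbhs_subspace_in // => -[eta /= eta0 h].
by exists eta => // t At st; exact: (h t st At).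
Qed.

Lemma nincr_of_derive (R : realType) (f df : R -> R) (a b : R) : a <= b ->
  {within `[a, b], continuous f} ->
  (forall t, a < t < b -> is_derive t 1 f (df t)) ->
  (forall t, a < t < b -> df t <= 0) -> f b <= f a.
Proof.
move=> ab cf f' df0.
apply: (@ler0_derive1_le_cc _ f a b) => //; rewrite ?in_itv /= ?lexx ?ab //.
  by move=> t; rewrite in_itv /= => /f' [].
move=> t; rewrite in_itv /= => abt; have [_] := f' t abt.
by rewrite derive1E => ->; exact: df0.
Qed.

(** * Trajectories trapped by a decaying Lyapunov function that bounds the speed *)

Section Trap.
Variables (R : realType) (N : nat) (x0 : 'cV[R]_N) (X : 'cV[R]_N -> 'cV[R]_N)
  (W : 'cV[R]_N -> R) (rho C kappa : R).
Hypotheses (rho0 : 0 < rho) (C0 : 0 <= C) (kappa0 : 0 < kappa).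
Hypotheses (Wx0 : W x0 = 0) (W0 : forall x, 0 <= W x) (cW : continuous W).
Hypothesis X_le : forall x, `|x - x0| <= rho -> `|X x| <= C * Num.sqrt (W x).
Hypothesis W_decay : forall (p : R -> 'cV[R]_N) t, `|p t - x0| <= rho ->
  is_derive t 1 p (X (p t)) ->
  exists2 w, is_derive t 1 (W \o p) w & w <= - (2 * kappa) * W (p t).

(** Gronwall's argument: [W (p t) e^(2 kappa t)] is nonincreasing. The decay factor is kept as a
    square because the speed is governed by the square root of [W]. *)
Let W_bound (p : R -> 'cV[R]_N) (T : R) : 0 <= T ->
  {within `[0, T], continuous p} ->
  (forall t, 0 < t < T -> `|p t - x0| <= rho /\ is_derive t 1 p (X (p t))) ->
  W (p T) <= W (p 0) * expR (- kappa * T) ^+ 2.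
Proof.
move=> T0 cp hp.
have step t : exists w, 0 < t < T ->
    is_derive t 1 (W \o p) w /\ w <= - (2 * kappa) * W (p t).
  have [tT|ntT] := boolP (0 < t < T); last by exists 0.
  by have [h1 h2] := hp t tT; have [w w1 w2] := W_decay h1 h2; exists w.
have [w Hw] := choice step.
pose E (t : R) := 1 * expR (2 * kappa * t).
have E0 t : 0 <= E t by rewrite /E mul1r expR_ge0.
have := @nincr_of_derive R ((W \o p) * E)
  (fun t => W (p t) *: (2 * kappa * 1 * expR (2 * kappa * t)) + E t *: w t) 0 T T0.
rewrite /= -![(_ * _ : _ -> _) _]/(_ * _) /= => H.
have {H} : W (p T) * E T <= W (p 0) * E 0.
  apply: H.
  - move=> t; apply: continuousM.
      exact: (@within_continuous_comp _ _ _ _ p W).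
    exact/continuous_subspaceT/continuous_expM.
  - move=> t tT; apply: is_deriveM; first exact: (Hw t tT).1.
    exact: is_derive_expM.
  - move=> t tT; have := (Hw t tT).2; have := E0 t; rewrite /GRing.scale /= /E.
    by rewrite mul1r mulr1 => e0 hw; nra.
have eq1 : E T * expR (- kappa * T) ^+ 2 = 1.
  rewrite /E mul1r -expRM_natl -expRD.
  by rewrite (_ : _ + _ = 0) ?expR0 //; ring.
rewrite {2}/E mulr0 expR0 !mulr1 => h.
rewrite -[leLHS]mulr1 -eq1 mulrA ler_wpM2r // sqr_ge0.
Qed.

(** The speed is at most [C sqrt(W (p 0)) e^(- kappa t)]; the right-hand side is the increment of a
    primitive of this bound. *)
Let p_bound (p : R -> 'cV[R]_N) (T : R) :
  {within `[0, T], continuous p} ->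
  (forall t, 0 < t < T -> `|p t - x0| <= rho /\ is_derive t 1 p (X (p t))) ->
  forall s t, 0 <= s -> s <= t -> t <= T -> `|p t - p s| <=
    C * Num.sqrt (W (p 0)) / kappa * (expR (- kappa * s) - expR (- kappa * t)).
Proof.
move=> cp hp s t s0 st tT.
pose c := - (C * Num.sqrt (W (p 0)) / kappa).
have := @norm_sub_le_derive R _ _ p (X \o p) (fun t => c * expR (- kappa * t))
  (fun t => - kappa * c * expR (- kappa * t)) s t st.
have -> : c * expR (- kappa * t) - c * expR (- kappa * s) =
  C * Num.sqrt (W (p 0)) / kappa * (expR (- kappa * s) - expR (- kappa * t)).
  by rewrite /c; ring.
apply.
- by apply: continuous_subspaceW cp; apply: subset_itv; rewrite bnd_simp.
- exact/continuous_subspaceT/continuous_expM.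
- move=> z /andP[sz zt]; apply: (hp z _).2.
  by rewrite (le_lt_trans s0) //= (lt_le_trans zt).
- by move=> z _; exact: is_derive_expM.
- move=> z /andP[sz zt].
  have zT : 0 < z < T by rewrite (le_lt_trans s0) //= (lt_le_trans zt).
  apply: (le_trans (X_le (hp z zT).1)).
  have -> : - kappa * c * expR (- kappa * z) =
      C * (Num.sqrt (W (p 0)) * expR (- kappa * z)).
    by rewrite /c; field; rewrite gt_eqF.
  rewrite ler_wpM2l //.
  rewrite -[X in _ <= _ * X]ger0_norm ?expR_ge0 // -sqrtr_sqr -sqrtrM //.
  rewrite ler_sqrt ?mulr_ge0 ?sqr_ge0 //.
  move/andP: zT => [z0 zT]; apply: W_bound; first exact: ltW.
    by apply: continuous_subspaceW cp; apply: subset_itv; rewrite bnd_simp // ltW.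
  by move=> u /andP[u0 uz]; apply: hp; rewrite u0 (lt_trans uz).
Qed.

(** A bootstrap: the speed bound holds only inside the ball, but as long as it holds the path is too
    short to leave. The equation is required only inside the ball, so the lemma covers both true
    solutions and solutions of a field altered outside. *)
Lemma exponential_trap : exists2 delta, 0 < delta &
  forall p : R -> 'cV[R]_N, `|p 0 - x0| < delta ->
  {within `[0, +oo[, continuous p} ->
  (forall t : R, 0 < t -> `|p t - x0| <= rho -> is_derive t 1 p (X (p t))) ->
  (forall t : R, 0 <= t -> `|p t - x0| <= rho) /\
  exists q, [/\ `|q - x0| <= rho, W q = 0 &
    forall t : R, 0 <= t -> `|q - p t| <= rho * expR (- kappa * t)].
Proof.
(* The radius is split into quarters: one for the initial distance, one for the length of the path,
   one for the continuity slack at the exit time. [C + 1] guards the division against [C = 0]. *)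
have [delta [d0 drho dW]] : exists delta, [/\ 0 < delta, delta <= rho / 4 &
    forall x, `|x - x0| < delta -> C * Num.sqrt (W x) / kappa <= rho / 4].
  have e0 : 0 < rho / 4 * kappa / (C + 1).
    by rewrite divr_gt0 ?mulr_gt0 ?divr_gt0 // ltr_wpDl.
  have : {for x0, continuous (Num.sqrt \o W)}.
    by apply: continuous_comp; [exact: cW|exact: sqrt_continuous].
  move=> /cvgrPdist_le /(_ _ e0) /nbhs_ballP[eta /= eta0 h].
  exists (Num.min eta (rho / 4)); split.
  - by rewrite lt_min eta0 divr_gt0.
  - by rewrite ge_min lexx orbT.
  - move=> x; rewrite lt_min => /andP[xe _].
    have := h x; rewrite -ball_normE /= distrC => /(_ xe).
    rewrite Wx0 sqrtr0 sub0r normrN ger0_norm ?sqrtr_ge0 // => sW.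
    rewrite ler_pdivrMr //.
    have := sqrtr_ge0 (W x); rewrite ler_pdivlMr ?ltr_wpDl // in sW.
    by nra.
exists delta => // p p0 cp hp.
have cpT T : {within `[0, T], continuous p}.
  by apply: continuous_subspaceW cp; apply: subset_itv; rewrite bnd_simp.
set c := C * Num.sqrt (W (p 0)) / kappa.
have c4 : c <= rho / 4 by exact: dW.
have c0 : 0 <= c by rewrite divr_ge0 ?mulr_ge0 ?sqrtr_ge0 // ltW.
have eN (t : R) : 0 <= t -> expR (- kappa * t) <= 1.
  by move=> t0; rewrite -expR0 ler_expR mulNr oppr_le0 mulr_ge0 // ltW.
have stay (t : R) : 0 <= t -> `|p t - x0| < rho.
  move=> t0; rewrite ltNge; apply/negP => tout.
  pose E := [set t | 0 <= t /\ rho <= `|p t - x0|].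
  have infE : has_inf E by split; [exists t | exists 0 => ? []].
  pose s := inf E.
  have s0 : 0 <= s by apply: lb_le_inf; [case: infE | move=> ? []].
  have sin u : 0 <= u -> u < s -> `|p u - x0| < rho.
    move=> u0 us; rewrite ltNge; apply/negP => uout.
    suff : s <= u by rewrite leNgt us.
    by apply: ge_inf; [case: infE | split].
  have ps : `|p s - p 0| <= rho / 4.
    have h := @p_bound p s (cpT s) _ 0 s (lexx _) s0 (lexx _).
    rewrite mulr0 expR0 in h; apply: (le_trans (h _)).
      move=> u /andP[u0 us]; have pu := ltW (sin u (ltW u0) us).
      by split => //; exact: hp.
    apply: le_trans c4; rewrite -/c -[leRHS]mulr1 ler_wpM2l //.
  have e0 : 0 < rho / 4 by rewrite divr_gt0.
  have sI : `[0, +oo[%classic s by rewrite /= in_itv /= s0.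
  have [eta eta0 heta] := within_continuous_dist cp sI e0.
  (* The infimum [s] is compared with a point [u] of [E] just after it: [p u] is outside yet within
     [rho / 4] of [p s], hence at distance less than [3 rho / 4] from [x0]. *)
  have [u [u0 uout] us] := inf_adherent eta0 infE.
  have su : s <= u by apply: ge_inf; [case: infE | split].
  have := heta u; rewrite /= in_itv /= u0 => /(_ isT).
  have -> : `|s - u| < eta by rewrite distrC ger0_norm ?subr_ge0 // ltrBlDr addrC.
  move=> /(_ isT) psu.
  have := ler_normD (p u - p s) (p s - x0); rewrite subrKA.
  have := ler_normD (p s - p 0) (p 0 - x0); rewrite subrKA.
  by rewrite distrC in psu; lra.
have Hp t : 0 < t -> `|p t - x0| <= rho /\ is_derive t 1 p (X (p t)).
  move=> t0; have := ltW (stay t (ltW t0)).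
  by split => //; exact: hp.
split=> [t /stay/ltW //|].
pose r (t : R) := c * expR (- kappa * t).
have r0 t : 0 <= r t by rewrite mulr_ge0 ?expR_ge0.
have pr (s t : R) : 0 <= s -> s <= t -> `|p t - p s| <= r t + r s.
  move=> s0 st; have h := @p_bound p t (cpT t) _ s t s0 st (lexx _).
  apply: (le_trans (h _)).
    by move=> u /andP[u0 _]; exact: Hp.
  rewrite mulrBr -/(r s) -/(r t); have := r0 t; lra.
have m0 (t : R) : 0 <= Num.max t 0 by rewrite le_max lexx orbT.
have [q Hq] : exists q, forall t, `|q - p (Num.max t 0)| <= r (Num.max t 0).
  apply: (limit_of_radii (0 : R)) => s t.
  have := m0 s; have := m0 t; move: (Num.max s 0) (Num.max t 0) => {}s {}t t0 s0.
  have [st|/ltW ts] := leP s t; last exact: pr.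
  by rewrite distrC [leRHS]addrC; apply: pr => //; exact: ltW.
have {}Hq (t : R) : 0 <= t -> `|q - p t| <= r t.
  by move=> t0; have := Hq t; rewrite max_l.
exists q; split.
- have := ler_normD (q - p 0) (p 0 - x0); rewrite subrKA.
  have := Hq 0 (lexx _); rewrite /r mulr0 expR0 mulr1; lra.
- apply/eqP; rewrite eq_le W0 andbT leNgt; apply/negP => Wq.
  have Wq2 : 0 < W q / 2 by rewrite divr_gt0.
  have /(@cvgrPdist_lt _ _ _ (nbhs q))/(_ _ Wq2) : {for q, continuous W}.
    exact: cW.
  move=> /nbhs_ballP[eta /= eta0 h].
  (* At time [a / kappa] the factor [E] is [e^(- a)], and [1 + a <= e^a] gives [a E < 1]. The two
     summands of [a] make [rho E < eta] and [W (p 0) E < W q / 2] at once, contradicting continuity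
     of [W] at [q]. *)
  pose a := rho / eta + W (p 0) / (W q / 2).
  have a1 : 0 <= rho / eta by rewrite divr_ge0 // ltW.
  have a2 : 0 <= W (p 0) / (W q / 2) by rewrite divr_ge0 // ltW.
  pose t := a / kappa.
  have t0 : 0 <= t by rewrite divr_ge0 ?addr_ge0 // ltW.
  pose E := expR (- kappa * t).
  have E0 : 0 < E by exact: expR_gt0.
  have EE : E * expR a = 1.
    rewrite /E -expRD /t (_ : _ + a = 0) ?expR0 //.
    by field; rewrite gt_eqF.
  have aE : a * E < 1.
    by have := expR_ge1Dx a; rewrite -(ler_pM2l E0) EE; lra.
  have E1 : rho * E < eta.
    rewrite -[ltRHS]mul1r -ltr_pdivrMr // mulrAC.
    by apply: le_lt_trans aE; rewrite ler_wpM2r ?(ltW E0) // /a lerDl.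
  have := h (p t); rewrite -ball_normE /=.
  have -> : `|q - p t| < eta.
    apply: le_lt_trans E1; apply: (le_trans (Hq t t0)).
    by rewrite ler_wpM2r ?(ltW E0) //; lra.
  move=> /(_ isT) /ltr_normlW.
  have := W_bound t0 (cpT t); rewrite -/E => wt.
  have {wt} : W (p t) <= W (p 0) * E ^+ 2 by apply: wt => u /andP[u0 _]; exact: Hp.
  have Ele : E <= 1 by exact: eN.
  have E2 : W (p 0) * E < W q / 2.
    rewrite -[ltRHS]mul1r -ltr_pdivrMr // mulrAC.
    by apply: le_lt_trans aE; rewrite ler_wpM2r ?(ltW E0) // /a lerDr.
  have : W (p 0) * E ^+ 2 <= W (p 0) * E.
    by rewrite ler_wpM2l // expr2 ler_piMl // ltW.
  by lra.
- move=> t t0; apply: (le_trans (Hq t t0)).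
  by rewrite ler_wpM2r ?expR_ge0 //; lra.
Qed.

End Trap.

(** The sup-norm ball is a cube, so clamping each coordinate retracts onto it without increasing
    distances. The clamped field is bounded and globally Lipschitz and agrees with [X] on the ball;
    [L + 1] ensures a positive Lipschitz constant. *)
Lemma local_solution_exists (R : realType) (N : nat) (x0 : 'cV[R]_N)
    (X : 'cV[R]_N -> 'cV[R]_N) (rho L : R) : 0 < rho -> 0 <= L ->
  (forall x y, `|x - x0| <= rho -> `|y - x0| <= rho ->
    `|X x - X y| <= L * `|x - y|) ->
  forall p0, exists p : R -> 'cV[R]_N, [/\ p 0 = p0, continuous p &
    forall t : R, 0 < t -> `|p t - x0| <= rho -> is_derive t 1 p (X (p t))].
Proof.
move=> rho0 L0 XL p0.
pose clamp (x : 'cV[R]_N) : 'cV[R]_N :=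
  \col_i Num.max (Num.min (x i 0) (x0 i 0 + rho)) (x0 i 0 - rho).
have clamp_in x : `|clamp x - x0| <= rho.
  apply: mx_norm_leP => [|i j]; first exact: ltW.
  rewrite ord1 !mxE ler_norml.
  by case: (leP (x i 0) (x0 i 0 + rho)) => ?;
    case: (leP _ (x0 i 0 - rho)) => ?; apply/andP; split; lra.
have clamp_id x : `|x - x0| <= rho -> clamp x = x.
  move=> xr; apply/colP => i; rewrite !mxE.
  have := le_trans (le_mx_norm _ i 0) xr; rewrite !mxE ler_norml => /andP[h1 h2].
  by rewrite min_l ?max_l //; lra.
have clamp_lip x y : `|clamp x - clamp y| <= `|x - y|.
  apply: mx_norm_leP => // i j; rewrite ord1 !mxE.
  apply: (le_trans (maxr_lipschitz _ _ _)).
  apply: (le_trans (minr_lipschitz _ _ _)).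
  by have := le_mx_norm (x - y) i 0; rewrite !mxE.
have L1 : 0 < L + 1 by rewrite ltr_wpDl.
have [||p [pp cp dp]] := @picard_exists R N (X \o clamp) (L + 1)
    (`|X x0| + L * rho) L1 _ _ p0.
- move=> x z; apply: (le_trans (XL _ _ (clamp_in x) (clamp_in z))).
  apply: (@le_trans _ _ (L * `|x - z|)); first by rewrite ler_wpM2l.
  by rewrite ler_wpM2r // lerDl.
- move=> x /=; rewrite -[X (clamp x)](subrK (X x0)) addrC.
  apply: (le_trans (ler_normD _ _)); rewrite lerD2l.
  have x00 : `|x0 - x0| <= rho by rewrite subrr normr0 ltW.
  apply: (le_trans (XL _ _ (clamp_in x) x00)).
  by rewrite ler_wpM2l.
- exists p; split=> // t t0 pt.
  by have := dp t t0; rewrite /= clamp_id.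
Qed.

(** * Differentiability from continuous partial derivatives *)

Definition frechet_at (R : realType) (N M : nat) (f : 'cV[R]_N -> 'cV[R]_M)
    (m : 'cV[R]_N) (A : 'M[R]_(M, N)) : Prop :=
  forall eps, 0 < eps -> exists2 delta, 0 < delta &
    forall h, `|h| <= delta -> `|f (m + h) - f m - A *m h| <= eps * `|h|.

Section Frechet.
Variables (R : realType) (N M : nat).
Implicit Types (f : 'cV[R]_N -> 'cV[R]_M).

Lemma is_derive_line f (x v : 'cV[R]_N) (s : R) : derivable f (x + s *: v) v ->
  is_derive s (1 : R) (fun u : R => f (x + u *: v)) ('D_v f (x + s *: v)).
Proof.
move=> df.
have E : (fun h : R => h^-1 *:
      (((fun u => f (x + u *: v)) \o shift s) (h *: (1 : R)) - f (x + s *: v))) =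
    (fun h => h^-1 *: ((f \o shift (x + s *: v)) (h *: v) - f (x + s *: v))).
  apply/funext => h /=; congr (_ *: (f _ - _)).
  by rewrite [h *: 1]mulr1 scalerDl addrCA.
by split; rewrite /derivable /derive /= E.
Qed.

(** [class_C] speaks of partial derivatives only. The total derivative comes from moving from [m] to
    [m + h] one coordinate at a time: each of the [N] moves costs at most [eps' * |h|], whence
    [eps / N.+1]. *)
Lemma class_C1_frechet (V : set 'cV[R]_N) f (m : 'cV[R]_N) :
  open V -> V m -> class_C 1 V f -> exists A : 'M[R]_(M, N),
  frechet_at f m A.
Proof.
move=> oV Vm /= [_ df].
pose e k : 'cV[R]_N := delta_mx k 0.
exists (\matrix_(i, j) ('D_(e j) f m) i 0) => eps eps0.
set A := \matrix_(_, _) _.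
have Ae k : A *m e k = 'D_(e k) f m.
  by rewrite -colE; apply/colP => i; rewrite !mxE.
pose eps' := eps / N.+1%:R.
have eps'0 : 0 < eps' by rewrite divr_gt0.
have [delta d0 hd] : exists2 delta, 0 < delta & forall x, `|x - m| <= delta ->
    V x /\ forall k, `|'D_(e k) f m - 'D_(e k) f x| <= eps'.
  have H : \forall x \near m,
      V x /\ forall k, `|'D_(e k) f m - 'D_(e k) f x| <= eps'.
    near=> x; split; first by near: x; exact: open_nbhs_nbhs.
    near: x; apply: filter_forall => k.
    by have [_ [/(_ m Vm)/cvgrPdist_le/(_ _ eps'0)]] := df k.
  move: H => /nbhs_ballP[delta /= d0 H].
  exists (delta / 2); first by rewrite divr_gt0.
  move=> x xm; apply: H; rewrite -ball_normE /= distrC (le_lt_trans xm) //; lra.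
exists delta => // h hdelta.
(* [hk k] keeps the first [k] coordinates of [h]. All corners and edges of this staircase stay
   within sup distance [|h|] of [m]. *)
pose hk k : 'cV[R]_N := \col_i (if (i < k)%N then h i 0 else 0).
have hkS k (kN : (k < N)%N) :
    hk k.+1 = hk k + h (Ordinal kN) 0 *: e (Ordinal kN).
  apply/colP => i; rewrite !mxE eqxx andbT ltnS leq_eqVlt -val_eqE /=.
  have [ik|ik] /= := eqVneq (val i) k.
    by rewrite ik ltnn add0r mulr1; congr (h _ 0); exact: val_inj.
  by rewrite mulr0 addr0.
have stepk k : (k <= N)%N -> `|f (m + hk k) - f m - A *m hk k| <=
    k%:R * (eps' * `|h|).
  elim: k => [_|k IH kN].
    have -> : hk 0%N = 0 by apply/colP => i; rewrite !mxE.
    by rewrite addr0 subrr mulmx0 subrr normr0 mul0r.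
  set o := Ordinal kN.
  (* Its derivative is the variation of one partial derivative between [m] and the current point,
     which [hd] bounds by [eps']. *)
  pose phi s := s *: 'D_(e o) f m - f (m + hk k + s *: e o).
  have -> : f (m + hk k.+1) - f m - A *m hk k.+1 =
      (phi 0 - phi (h o 0)) + (f (m + hk k) - f m - A *m hk k).
    rewrite /phi hkS mulmxDr -scalemxAr Ae !scale0r sub0r addr0 -/o addrA.
    by apply/colP => i; rewrite !mxE; ring.
  apply: (le_trans (ler_normD _ _)); rewrite -natr1 addrC mulrDl mul1r.
  apply: lerD; first exact/IH/ltnW.
  have seg s : `|s| <= `|h| -> V (m + hk k + s *: e o) /\
      `|'D_(e o) f m - 'D_(e o) f (m + hk k + s *: e o)| <= eps'.
    move=> sh; have /hd[] : `|m + hk k + s *: e o - m| <= delta.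
      rewrite -(addrA m) [m + _]addrC addrK; apply: (@le_trans _ _ `|h|) => //.
      apply: mx_norm_leP => // i j; rewrite ord1 !mxE eqxx andbT -val_eqE /=.
      case: ltngtP => _; rewrite ?mulr0 ?mulr1 ?addr0 ?add0r ?normr0 //.
      exact: le_mx_norm.
    by move=> Vx /(_ o).
  have phi' s : `|s| <= `|h| -> is_derive s (1 : R) phi
      ('D_(e o) f m - 'D_(e o) f (m + hk k + s *: e o)).
    move=> /seg[Vs _]; apply: is_deriveB; last first.
      by apply: is_derive_line; case: (df o) => + _; apply.
    apply: is_derive_mx => i j.
    have -> : (fun u : R => (u *: 'D_(e o) f m) i j) = *%R ('D_(e o) f m i j).
      by apply/funext => u; rewrite mxE mulrC.
    by rewrite -[X in is_derive _ _ _ X]mulr1; exact: is_deriveZ.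
  have ineq a b : a <= b -> `|a| <= `|h| -> `|b| <= `|h| ->
      `|phi b - phi a| <= eps' * (b - a).
    move=> ab ah bh; rewrite mulrBr.
    have inab s : a <= s <= b -> `|s| <= `|h|.
      move: ah bh; rewrite !ler_norml => /andP[? _] /andP[_ ?] /andP[? ?].
      by apply/andP; split; lra.
    apply: (@norm_sub_le_derive _ _ _ phi
      (fun s => 'D_(e o) f m - 'D_(e o) f (m + hk k + s *: e o))
      ( *%R eps') (cst eps')) => //.
    - apply: derivable_within_continuous => z; rewrite in_itv /= => /inab /phi'.
      by case.
    - by apply: continuous_subspaceT => z; exact: mulrl_continuous.
    - by move=> z /andP[az zb]; apply/phi'/inab; rewrite !ltW.
    - by move=> z _; rewrite -[X in is_derive _ _ _ X]mulr1; exact: is_deriveZ.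
    - by move=> z /andP[az zb] /=; apply: (seg z _).2; apply: inab; rewrite !ltW.
  apply: (@le_trans _ _ (eps' * `|h o 0|)); last first.
    by rewrite ler_wpM2l ?(ltW eps'0) // le_mx_norm.
  have [h0|/ltW h0] := leP 0 (h o 0).
    have := ineq 0 _ h0; rewrite subr0 normr0 ger0_norm // distrC; apply => //.
    by rewrite -[X in X <= _]ger0_norm // le_mx_norm.
  have := ineq _ 0 h0; rewrite sub0r normr0 ler0_norm //; apply => //.
  by rewrite -[X in X <= _]ler0_norm // le_mx_norm.
have hN : hk N = h by apply/colP => i; rewrite !mxE ltn_ord.
have := stepk N (leqnn N); rewrite hN => /le_trans; apply.
rewrite mulrA ler_wpM2r // /eps' mulrCA ler_piMr ?(ltW eps0) //.
by rewrite ler_pdivrMr // mul1r ler_nat.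
Unshelve. all: by end_near. Qed.
End Frechet.

Lemma is_derive_sum_sqr (R : realType) (V : normedModType R) (n : nat)
    (f : 'I_n -> V -> R) (x v : V) (df : 'I_n -> R) :
  (forall k, is_derive x v (f k) (df k)) ->
  is_derive x v (fun y => \sum_k f k y ^+ 2) (2 * \sum_k f k x * df k).
Proof.
move=> h.
have -> : (fun y => \sum_k f k y ^+ 2) = \sum_(k < n) (f k ^+ 2).
  by apply/funext => y; rewrite fct_sumE.
apply: is_derive_eq (is_derive_sum (fun k => is_deriveX 2 (h k))) _.
rewrite mulr_sumr; apply: eq_bigr => k _.
by rewrite /GRing.scale /= expr1; ring.
Qed.

(** * The distance map and its image *)

Section Rigidity.
Variables (R : realType) (n d : nat) (e : rel 'I_n).
Local Notation conf := 'cV[R]_(n * d).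
Implicit Types (p q : conf).

Lemma edge_lt (a : 'I_#|edges e|) : ((edge a).1 < (edge a).2)%N.
Proof. by have := enum_valP a; rewrite inE => /andP[]. Qed.

Definition edge_vec p (a : 'I_#|edges e|) (k : 'I_d) : R :=
  p (mxvec_index (edge a).1 k) 0 - p (mxvec_index (edge a).2 k) 0.

(** Replaces the case distinction by a signed incidence coefficient, which makes linearity in [p]
    visible; the indicators never overlap, as the endpoints of an edge are distinct. *)
Lemma rigmxE p a v k : rigmx e p a (mxvec_index v k) =
  ((v == (edge a).1)%:R - (v == (edge a).2)%:R) * edge_vec p a k.
Proof.
rewrite mxE mxvecE mxE /edge_vec; have := edge_lt a.
case: (edge a) => i j /= ij.
have [->|vi] := eqVneq v i.
  by rewrite (negPf (_ : i != j)) ?neq_ltn ?ij // subr0 mul1r !mxE.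
by case: (eqVneq v j) => _ /=; rewrite !mxE ?mulr1n ?mulr0n; ring.
Qed.

Lemma sum_mxvec (f : 'I_(n * d) -> R) :
  \sum_l f l = \sum_v \sum_k f (mxvec_index v k).
Proof.
rewrite pair_big /= (reindex (uncurry (@mxvec_index n d))) /=.
  by apply: eq_bigr => -[].
exact: (subon_bij _ (curry_mxvec_bij _ _)).
Qed.

Lemma rigmx_mulE p q a :
  (rigmx e p *m q) a 0 = \sum_k edge_vec p a k * edge_vec q a k.
Proof.
rewrite mxE sum_mxvec exchange_big; apply: eq_bigr => k _ /=.
rewrite (eq_bigr (fun v => edge_vec p a k *
    ((v == (edge a).1)%:R * q (mxvec_index v k) 0
     - (v == (edge a).2)%:R * q (mxvec_index v k) 0))); last first.
  by move=> v _; rewrite rigmxE; ring.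
rewrite -mulr_sumr sumrB [in RHS]/edge_vec; congr (_ * (_ - _)).
  rewrite (bigD1 (edge a).1) //= eqxx mul1r big1 ?addr0 // => v /negPf->.
  by rewrite mul0r.
rewrite (bigD1 (edge a).2) //= eqxx mul1r big1 ?addr0 // => v /negPf->.
by rewrite mul0r.
Qed.

Lemma distmapE p a : distmap e p a 0 = \sum_k edge_vec p a k ^+ 2.
Proof.
rewrite mxE /enorm sqr_sqrtr; last first.
  by apply: sumr_ge0 => i _; apply: sumr_ge0 => *; exact: sqr_ge0.
rewrite big_ord1; apply: eq_bigr => k _.
by rewrite /edge_vec -[RHS]sqrrN opprB !mxE.
Qed.

Lemma distmap_rigmx p : distmap e p = rigmx e p *m p.
Proof. by apply/colP => a; rewrite distmapE rigmx_mulE. Qed.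

(** [rigmx e p *m q] is the polar form of the quadratic map [F]. Its symmetry yields the exact
    expansions [distmap_sub] and [distmapD]. *)
Lemma rigmx_mulC p q : rigmx e p *m q = rigmx e q *m p.
Proof.
by apply/colP => a; rewrite !rigmx_mulE; apply: eq_bigr => k _; rewrite mulrC.
Qed.

Lemma rigmx_linear (c : R) p q :
  rigmx e (c *: p + q) = c *: rigmx e p + rigmx e q.
Proof.
apply/matrixP => a l; case/mxvec_indexP: l => v k.
by rewrite [RHS]mxE [(c *: rigmx e p) _ _]mxE !rigmxE /edge_vec !mxE; ring.
Qed.

Lemma rigmxD p q : rigmx e (p + q) = rigmx e p + rigmx e q.
Proof. by rewrite -[p]scale1r rigmx_linear !scale1r. Qed.

Lemma rigmxZ (c : R) p : rigmx e (c *: p) = c *: rigmx e p.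
Proof.
apply/matrixP => a l; case/mxvec_indexP: l => v k.
by rewrite [RHS]mxE !rigmxE /edge_vec !mxE; ring.
Qed.

Lemma rigmxB p q : rigmx e (p - q) = rigmx e p - rigmx e q.
Proof. by rewrite rigmxD -scaleN1r rigmxZ scaleN1r. Qed.

Lemma edge_neq (a : 'I_#|edges e|) : ((edge a).1 == (edge a).2) = false.
Proof. by rewrite -val_eqE /= ltn_eqF // edge_lt. Qed.

Lemma norm_rigmx_entry p a v k :
  `|rigmx e p a (mxvec_index v k)| <= `|edge_vec p a k|.
Proof.
rewrite rigmxE normrM -[leRHS]mul1r ler_wpM2r //.
have [->|_] := eqVneq v (edge a).1; first by rewrite edge_neq subr0 normr1.
by case: eqVneq => _; rewrite sub0r normrN ?normr1 ?normr0.
Qed.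

Lemma norm_rigmx p : `|rigmx e p| <= 2 * `|p|.
Proof.
apply: mx_norm_leP => [|a l]; first by rewrite mulr_ge0.
case/mxvec_indexP: l => v k; apply: (le_trans (norm_rigmx_entry _ _ _ _)).
by rewrite (le_trans (ler_normB _ _)) // mulr2n mulrDl mul1r lerD // le_mx_norm.
Qed.

(** Entries of [R(p)] are coordinates of edge vectors up to sign, and [|x| <= 1 + x^2]. Unlike
    [norm_rigmx], the bound is insensitive to translations of [p]. *)
Lemma norm_rigmx_distmap p : `|rigmx e p| <= 1 + `|distmap e p|.
Proof.
apply: mx_norm_leP => [|a l]; first by rewrite addr_ge0.
case/mxvec_indexP: l => v k; apply: (le_trans (norm_rigmx_entry _ _ _ _)).
have : edge_vec p a k ^+ 2 <= `|distmap e p|.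
  apply: (le_trans _ (le_mx_norm _ a 0)); rewrite distmapE.
  rewrite ger0_norm; last by apply: sumr_ge0 => *; exact: sqr_ge0.
  by rewrite (bigD1 k) //= lerDl; apply: sumr_ge0 => *; exact: sqr_ge0.
have := normr_ge0 (distmap e p); rewrite -(real_normK (num_real (edge_vec p a k))).
by have := normr_ge0 (edge_vec p a k); nra.
Qed.

Lemma distmap_eq_rigmx p q : rigmx e p = rigmx e q -> distmap e p = distmap e q.
Proof.
move=> pq; apply/colP => a; rewrite !distmapE; apply: eq_bigr => k _.
have : rigmx e p a (mxvec_index (edge a).1 k) =
    rigmx e q a (mxvec_index (edge a).1 k) by rewrite pq.
by rewrite !rigmxE eqxx edge_neq subr0 !mul1r => ->.
Qed.

Lemma distmap_sub p q : distmap e p - distmap e q = rigmx e (p + q) *m (p - q).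
Proof.
rewrite !distmap_rigmx rigmxD mulmxDl !mulmxBr (rigmx_mulC q p).
by rewrite addrA subrK.
Qed.

Lemma distmapD p h :
  distmap e (p + h) = distmap e p + 2 *: (rigmx e p *m h) + distmap e h.
Proof.
rewrite !distmap_rigmx rigmxD mulmxDl !mulmxDr (rigmx_mulC h p).
by rewrite scaler_nat mulr2n !addrA.
Qed.

Lemma norm_distmap_sub p q :
  `|distmap e p - distmap e q| <= (n * d)%:R * (2 * (`|p| + `|q|) * `|p - q|).
Proof.
rewrite distmap_sub; apply: mx_norm_mulmx_le => //.
by apply: (le_trans (norm_rigmx _)); rewrite ler_wpM2l // ler_normD.
Qed.

Lemma distmap_continuous : continuous (@distmap R n d e).
Proof.
move=> p; apply: (@lipschitz_at_continuous _ _ _ _ _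
  ((n * d)%:R * (2 * (`|p| + (`|p| + 1))))) => q pq.
apply: (le_trans (norm_distmap_sub p q)).
rewrite [leLHS]mulrA ler_wpM2r // ler_wpM2l // ler_wpM2l // lerD2l.
by rewrite -[q](subKr p) (le_trans (ler_normB _ _)) // lerD2l.
Qed.

Lemma is_derive_distmap (p : R -> conf) (t : R) (v : conf) :
  is_derive t 1 p v ->
  is_derive t 1 (fun s => distmap e (p s)) (2 *: (rigmx e (p t) *m v)).
Proof.
move=> dp; apply: is_derive_mx => a j; rewrite ord1 {j}.
under [X in is_derive _ _ X _]funext => s do rewrite distmapE.
rewrite mxE rigmx_mulE; apply: is_derive_sum_sqr => k.
by apply: is_deriveB; exact: is_derive_coord.
Qed.

End Rigidity.

Lemma norm_mxvec (R : realType) (m n : nat) (A : 'M[R]_(m, n)) :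
  `|mxvec A| <= `|A|.
Proof.
apply: mx_norm_leP => // i j; rewrite ord1.
by case/mxvec_indexP: j => k l; rewrite mxvecE le_mx_norm.
Qed.

Lemma trmx_continuous (R : realType) (m n : nat) :
  continuous (@trmx R m n).
Proof.
apply: (@lipschitz_continuous _ _ _ _ 1) => x y.
by rewrite -linearB /= mx_norm_tr mul1r.
Qed.

(** * Openness of the set of regular points *)

Section RegularPoints.
Variables (R : realType) (n d : nat) (e : rel 'I_n).
Local Notation conf := 'cV[R]_(n * d).
Local Notation F := (@distmap R n d e).

Lemma rank_rigmx_le_max (p : conf) : (\rank (rigmx e p) <= max_rank R d e)%N.
Proof.
have h : (\rank (rigmx e p) < #|edges e|.+1)%N by rewrite ltnS rank_leq_row.
rewrite /max_rank; apply: (leq_trans _ (leq_bigmax_cond (Ordinal h) _)) => //=.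
by apply/asboolP; exists p.
Qed.

(** [p] to [R(p)] is linear, with matrix [G] after vectorization, so [pinvmx G] provides a bounded
    linear section over its image. Fibres of [F] are unbounded because of translations; this
    replaces a point by one with the same rigidity matrix and controlled size. *)
Lemma bounded_representative : exists2 C : R, 0 <= C &
  forall q : conf, exists q' : conf,
    rigmx e q' = rigmx e q /\ `|q'| <= C * (1 + `|F q|).
Proof.
pose f (u : 'rV[R]_(n * d)) := mxvec (rigmx e u^T).
have fl : linear f by move=> a u v; rewrite /f linearP rigmx_linear linearP.
pose fM := GRing.isLinear.Build R _ _ _ f fl.
pose fL : {linear 'rV[R]_(n * d) -> 'rV[R]_(#|edges e| * (n * d))} := HB.pack f fM.
pose G := lin1_mx fL.
have GE (q : conf) : q^T *m G = mxvec (rigmx e q).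
  by rewrite mul_rV_lin1 /= /f trmxK.
exists ((#|edges e| * (n * d))%:R * `|pinvmx G|); first by rewrite mulr_ge0.
move=> q; exists (q^T *m G *m pinvmx G)^T; split.
  apply: (can_inj mxvecK); rewrite -!GE trmxK mulmxKpV //; exact: submxMl.
rewrite mx_norm_tr GE; apply: (le_trans (mx_norm_mulmx _ _)).
rewrite -mulrA ler_wpM2l // mulrC ler_wpM2l //.
exact: le_trans (norm_mxvec _) (norm_rigmx_distmap _ _).
Qed.

Lemma rank_rigmx_lsc (p : conf) :
  \forall q \near p, (\rank (rigmx e p) <= \rank (rigmx e q))%N.
Proof.
have [delta [C [d0 _ h]]] := pinv_locally_bounded (rigmx e p).
near=> q; apply: (h _ _).1; rewrite -rigmxB.
apply: (le_trans (norm_rigmx _ _)); rewrite mulrC -ler_pdivlMr // distrC.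
near: q; apply: cvgr_dist_le; [exact: cvg_id|exact: divr_gt0].
Unshelve. all: by end_near. Qed.

(* Up to the kernel of the (linear) rigidity matrix, fibres over a bounded set
   are bounded; compactness then makes the rank condition on fibres open. *)
Lemma regular_points_nbhs (p : conf) :
  regular_points e p -> nbhs p (@regular_points R n d e).
Proof.
move=> [_ [rN [V [phi [psi [[oV Vm] oW sm inv sl]]]]] rkp].
have [C C0 rep] := bounded_representative.
set r := max_rank R d e in rkp sl.
pose B := C * (1 + (`|F p| + 1)).
(* The compact set of bounded configurations of deficient rank. Its image is closed and misses
   [F p], hence misses [F q] for [q] near [p]; the [+ 1] in [B] allows [F q] to vary by one unit. *)
pose K := [set v : 'rV[R]_(n * d) | `|v| <= B] `&`
  ~` [set v : 'rV[R]_(n * d) | (r <= \rank (rigmx e v^T))%N].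
have cK : compact K.
  apply: bounded_closed_compact.
    exists B; split; first exact: num_real.
    by move=> M BM v [/le_trans + _]; apply; exact: ltW.
  apply: closedI.
    apply: (@preimage_closed _ _ (fun v : 'rV[R]_(n * d) => `|v|) [set x | x <= B]).
      by move=> v _; exact: norm_continuous.
    exact: closed_le.
  apply: open_closedC; rewrite openE => v /= rv.
  have : \forall u \near v, (\rank (rigmx e v^T) <= \rank (rigmx e u^T))%N.
    exact: (@trmx_continuous R _ _ v
      [set u | (\rank (rigmx e v^T) <= \rank (rigmx e u))%N] (rank_rigmx_lsc v^T)).
  by move=> H; apply: (filterS _ H) => u /=; exact: leq_trans rv.
have cFK : closed ((F \o trmx) @` K).
  apply: compact_closed; first exact: norm_hausdorff.
  apply: continuous_compact cK; apply: continuous_subspaceT => v.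
  by apply: continuous_comp; [exact: trmx_continuous|exact: distmap_continuous].
have Fp : ~ ((F \o trmx) @` K) (F p).
  by move=> [v [_ vr] /rkp vp]; apply: vr; rewrite /= vp.
have cF := @distmap_continuous R n d e p.
near=> q; split; first by exists q.
  split=> //; exists V, phi, psi; split => //; split => //.
  near: q; apply: cF; exact: open_nbhs_nbhs.
move=> q1 q1q; apply/eqP; rewrite eqn_leq rank_rigmx_le_max /= leqNgt.
apply/negP => rk1.
have [q2 [q2R q2B]] := rep q1.
suff : ((F \o trmx) @` K) (F q).
  near: q; apply: (cF (~` _)); apply: open_nbhs_nbhs; split => //.
  exact: closed_openC.
exists q2^T; last by rewrite /= trmxK -q1q; exact: distmap_eq_rigmx.
split; last by rewrite /= trmxK q2R leqNgt rk1.
rewrite /= mx_norm_tr (le_trans q2B) // ler_wpM2l // lerD2l q1q.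
rewrite -[F q](subKr (F p)) (le_trans (ler_normB _ _)) // lerD2l.
near: q; exact: (@cvgr_dist_le _ _ _ _ _ _ _ cF).
Unshelve. all: by end_near. Qed.

End RegularPoints.

Lemma mulrCA_div (R : realType) (c x y : R) : 0 < c -> c * (x / c * y) = x * y.
Proof. by move=> c0; field; rewrite gt_eqF. Qed.

(** Chain rule for [psi \o phi = id] near [m]: [h - B A h] is [o(|h|)], and a linear map that is
    [o(|h|)] is zero. *)
Lemma frechet_left_inverse (R : realType) (N : nat) (phi psi : 'cV[R]_N -> 'cV[R]_N)
    (V : set 'cV[R]_N) (m : 'cV[R]_N) (A B : 'M[R]_N) :
  open V -> V m -> (forall x, V x -> psi (phi x) = x) ->
  frechet_at phi m A -> frechet_at psi (phi m) B -> B *m A = 1%:M.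
Proof.
move=> oV Vm inv dA dB.
have claim eps : 0 < eps -> forall h : 'cV[R]_N, `|h - B *m (A *m h)| <= eps * `|h|.
  move=> e0.
  pose c : R := N%:R * `|A| + 1; have c0 : 0 < c by rewrite ltr_wpDl // mulr_ge0.
  pose b : R := N%:R * `|B| + 1; have b0 : 0 < b by rewrite ltr_wpDl // mulr_ge0.
  have e1 : 0 < Num.min 1 (eps / 2 / b) by rewrite lt_min ltr01 !divr_gt0.
  have e2 : 0 < eps / 2 / c by rewrite !divr_gt0.
  have [d1 d10 H1] := dA _ e1; have [d2 d20 H2] := dB _ e2.
  have [d3 /= d30 H3] : nbhs_ball m V.
    by apply/nbhs_ballP; exact: open_nbhs_nbhs.
  have small (h : 'cV[R]_N) : `|h| <= d1 -> `|h| < d3 -> `|h| <= d2 / c ->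
      `|h - B *m (A *m h)| <= eps * `|h|.
    move=> hd1 hd3 hd2; pose k := phi (m + h) - phi m.
    have kA := H1 h hd1; rewrite -/k in kA.
    have Vh : V (m + h).
      by apply: H3; rewrite -ball_normE /= opprD addrA subrr sub0r normrN.
    have kc : `|k| <= c * `|h|.
      rewrite -[k](subrK (A *m h)) /c mulrDl mul1r addrC.
      apply: (le_trans (ler_normD _ _)); apply: lerD.
        by apply: (le_trans (mx_norm_mulmx _ _)); rewrite mulrA.
      by apply: (le_trans kA); rewrite -[leRHS]mul1r ler_wpM2r // ge_min lexx.
    have kd2 : `|k| <= d2.
      by apply: (le_trans kc); rewrite mulrC -ler_pdivlMr.
    have ek : phi m + k = phi (m + h) by rewrite /k addrC subrK.
    have := H2 k kd2; rewrite ek !inv // [m + h]addrC addrK => kB.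
    rewrite -(subrKA (B *m k)) -mulmxBr (splitr eps) mulrDl.
    apply: (le_trans (ler_normD _ _)); apply: lerD.
      apply: (le_trans kB); apply: (le_trans (ler_wpM2l (ltW e2) kc)).
      by rewrite mulrA divfK // gt_eqF.
    apply: (le_trans (mx_norm_mulmx _ _)).
    have kA' : `|k - A *m h| <= eps / 2 / b * `|h|.
      by apply: (le_trans kA); rewrite ler_wpM2r // ge_min lexx orbT.
    rewrite mulrA; apply: (@le_trans _ _ (b * (eps / 2 / b * `|h|))).
      by apply: ler_pM => //; rewrite ?mulr_ge0 // lerDl.
    by rewrite mulrCA_div.
  move=> h; have [->|h0] := eqVneq h 0.
    by rewrite !mulmx0 subrr !normr0 mulr0.
  (* Both sides of the claim are homogeneous in [h], so it suffices to treat the rescaling of [h] to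
     the admissible length [D]. *)
  pose D := Num.min d1 (Num.min (d3 / 2) (d2 / c)).
  have D0 : 0 < D by rewrite !lt_min d10 !divr_gt0.
  pose s := D / `|h|.
  have s0 : 0 < s by rewrite divr_gt0 // normr_gt0.
  have sh : `|s *: h| = D.
    by rewrite normrZ gtr0_norm // divfK // normr_eq0.
  have := small (s *: h); rewrite sh -!scalemxAr -scalerBr normrZ (gtr0_norm s0).
  have -> : eps * D = s * (eps * `|h|).
    by rewrite /s; field; rewrite normr_eq0.
  rewrite ler_pM2l //; apply.
  - by rewrite ge_min lexx.
  - apply: (@le_lt_trans _ _ (d3 / 2)); last by lra.
    by rewrite !ge_min lexx !orbT.
  - by rewrite !ge_min lexx !orbT.
have E (h : 'cV[R]_N) : B *m A *m h = h.
  apply/esym/eqP; rewrite -subr_eq0 -normr_le0 -mulmxA.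
  apply/ler_addgt0Pr => eps e0; rewrite add0r.
  have e1 : 0 < eps / (`|h| + 1) by rewrite divr_gt0 // ltr_wpDl.
  apply: (le_trans (claim _ e1 h)).
  rewrite mulrAC ler_pdivrMr ?ltr_wpDl // ler_wpM2l ?(ltW e0) //.
  by rewrite lerDl.
apply/matrixP => i j.
have /colP/(_ i) := E (delta_mx j 0).
by rewrite -colE !mxE => ->; rewrite eqxx andbT.
Qed.

(** * Chords of the image are nearly tangent *)

Section Tangent.
Variables (R : realType) (n d : nat) (e : rel 'I_n).
Local Notation conf := 'cV[R]_(n * d).
Local Notation F := (@distmap R n d e).

(** [T] is the differential of the chart coordinates of index at least [r]. These vanish on the
    image, so [T] sends its chords to first-order errors; the differential is invertible because
    [psi] inverts [phi], which gives the rank. *)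
Lemma slice_conormal (p : conf) (r : nat) :
  submanifold_near r (range F) (F p) ->
  exists2 T : 'M[R]_#|edges e|, \rank T = (#|edges e| - r)%N &
    forall eps, 0 < eps -> exists2 delta, 0 < delta &
      forall m, range F m -> `|m - F p| <= delta ->
        `|T *m (m - F p)| <= eps * `|m - F p|.
Proof.
move=> [rN [V [phi [psi [[oV Vm] oW [sphi spsi] inv sl]]]]].
set N := #|edges e|; set m0 := F p.
have [A dA] := class_C1_frechet oV Vm (sphi 1%N).
have [B dB] := class_C1_frechet oW (imageP phi Vm) (spsi 1%N).
have BA : B *m A = 1%:M := frechet_left_inverse oV Vm inv dA dB.
have [_ uA] := mulmx1_unit BA.
exists (copid_mx r *m A).
  by rewrite mxrankMfree ?row_free_unit // rank_copid_mx.
move=> eps e0.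
pose c : R := N%:R * `|copid_mx r : 'M[R]_N| + 1.
have c0 : 0 < c by rewrite ltr_wpDl // mulr_ge0.
have e1 : 0 < eps / c by rewrite divr_gt0.
have [d1 d10 H1] := dA _ e1.
have [d3 /= d30 H3] : nbhs_ball m0 V.
  by apply/nbhs_ballP; exact: open_nbhs_nbhs.
exists (Num.min d1 (d3 / 2)); first by rewrite lt_min d10 divr_gt0.
move=> m Sm; rewrite le_min => /andP[md1 md3].
have Vm' : V m.
  by apply: H3; rewrite -ball_normE /= distrC (le_lt_trans md3) //; lra.
have em : m0 + (m - m0) = m by rewrite addrC subrK.
have := H1 (m - m0) md1; rewrite em => h.
have z : copid_mx r *m (phi m - phi m0) = 0.
  apply/colP => i; rewrite mxE [RHS]mxE big1 // => j _.
  rewrite !mxE; have [->|ij] := eqVneq i j; last first.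
    by rewrite (_ : (i == j :> nat) = false) ?subrr ?mul0r //; apply/negbTE.
  rewrite eqxx /=; case: ltnP => jr; first by rewrite subrr mul0r.
  have S0 : range F m0 by exists p.
  by rewrite ((sl m Vm').1 Sm j jr) ((sl m0 Vm).1 S0 j jr) subrr mulr0.
have -> : copid_mx r *m A *m (m - m0) =
    - (copid_mx r *m (phi m - phi m0 - A *m (m - m0))).
  by rewrite [in RHS]mulmxBr z sub0r opprK mulmxA.
rewrite normrN; apply: (le_trans (mx_norm_mulmx _ _)); rewrite mulrA.
apply: (@le_trans _ _ (c * (eps / c * `|m - m0|))).
  by apply: ler_pM => //; rewrite ?mulr_ge0 // lerDl.
by rewrite mulrCA_div.
Qed.

(** Along [s |-> F (p + s w)] the chord is exactly [s u + s^2 z] with [u = 2 R(p) w] and [z = F w];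
    dividing the estimate on [T] by small [s] leaves [T u = 0]. *)
Lemma conormal_annihilates (p : conf) (T : 'M[R]_#|edges e|) :
  (forall eps, 0 < eps -> exists2 delta, 0 < delta &
      forall m, range F m -> `|m - F p| <= delta ->
        `|T *m (m - F p)| <= eps * `|m - F p|) ->
  T *m rigmx e p = 0.
Proof.
move=> HT.
suff H (w : conf) : T *m (rigmx e p *m w) = 0.
  apply/matrixP => i j; have /colP/(_ i) := H (delta_mx j 0).
  by rewrite mulmxA -colE !mxE.
pose u := 2 *: (rigmx e p *m w); pose z := F w.
have Fs (s : R) : F (p + s *: w) - F p = s *: u + s ^+ 2 *: z.
  rewrite /u /z distmapD !distmap_rigmx rigmxZ -!scalemxAl -!scalemxAr.
  move: (rigmx e p *m p) (rigmx e p *m w) (rigmx e w *m w) => x y z'.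
  by apply/colP => a; rewrite !mxE; ring.
suff : T *m u = 0.
  by rewrite /u -scalemxAr => /eqP; rewrite scaler_eq0 pnatr_eq0 /= => /eqP.
clearbody u z.
apply/eqP; rewrite -normr_le0; apply/ler_addgt0Pr => eta eta0; rewrite add0r.
pose k := `|u| + `|z| + 1.
have k0 : 0 < k by rewrite ltr_wpDl // addr_ge0.
have e0 : 0 < eta / 2 / k by rewrite !divr_gt0.
have [delta d0 Hd] := HT _ e0.
pose t := `|T *m z| + 1; have t0 : 0 < t by rewrite ltr_wpDl.
(* The three bounds give, in order, [s^2 <= s], a quadratic term of at most [eta / 2] after division
   by [s], and a chord no longer than [delta]. *)
pose s := Num.min 1 (Num.min (eta / 2 / t) (delta / k)).
have s0 : 0 < s by rewrite !lt_min ltr01 !divr_gt0.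
have s1 : s <= 1 by rewrite ge_min lexx.
have st : s * t <= eta / 2.
  by rewrite -ler_pdivlMr // !ge_min lexx !orbT.
have sk : s * k <= delta.
  by rewrite -ler_pdivlMr // !ge_min lexx !orbT.
have nF : `|F (p + s *: w) - F p| <= s * k.
  rewrite Fs (le_trans (ler_normD _ _)) // !normrZ !(gtr0_norm s0) -expr2.
  have : s ^+ 2 * `|z| <= s * `|z|.
    by rewrite ler_wpM2r // expr2 ler_piMl // ltW.
  by rewrite /k !mulrDr mulr1; lra.
have := Hd _ (ex_intro2 _ _ (p + s *: w) I erefl) (le_trans nF sk).
move/le_trans/(_ (ler_wpM2l (ltW e0) nF)).
rewrite Fs mulmxDr -!scalemxAr => h.
have : `|s *: (T *m u)| <= eta / 2 / k * (s * k) + s ^+ 2 * `|T *m z|.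
  rewrite -[s *: _](addrK (s ^+ 2 *: (T *m z))).
  apply: (le_trans (ler_normB _ _)); apply: lerD => //.
  by rewrite normrZ ger0_norm ?sqr_ge0.
rewrite normrZ gtr0_norm //.
have -> : eta / 2 / k * (s * k) + s ^+ 2 * `|T *m z| =
    s * (eta / 2 + s * `|T *m z|) by field; rewrite gt_eqF.
rewrite ler_pM2l // => /le_trans; apply.
rewrite [leRHS](splitr eta) lerD2l (le_trans _ st) // ler_wpM2l ?(ltW s0) //.
by rewrite lerDl.
Qed.

(** The rows of [T] lie in the left kernel of [R(p)], and the ranks agree because the dimension of
    the submanifold is [rk R(p)]. So they span it, and [1 - Pi] is a multiple [Z *m T]. *)
Lemma chord_tangent (p : conf) (eps : R) :
  submanifold_near (\rank (rigmx e p)) (range F) (F p) -> 0 < eps ->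
  exists2 delta, 0 < delta & forall q, `|F q - F p| <= delta ->
    `|F q - F p - tangent_proj e p *m (F q - F p)| <= eps * `|F q - F p|.
Proof.
move=> sub e0; have [T rT HT] := slice_conormal sub.
have TR := conormal_annihilates HT.
have [R1 R2 R3 R4] := @pinvP _ _ _ (rigmx e p).
have /submxP[Z hZ] : (1%:M - tangent_proj e p <= T)%MS.
  apply: (@submx_trans _ _ _ _ _ _ (kermx (rigmx e p))).
    by apply/sub_kermxP; rewrite mulmxBl mul1mx R1 subrr.
  have sT : (T <= kermx (rigmx e p))%MS by apply/sub_kermxP.
  by rewrite -(geq_leqif (mxrank_leqif_sup sT)) mxrank_ker rT.
pose c : R := #|edges e|%:R * `|Z| + 1.
have c0 : 0 < c by rewrite ltr_wpDl // mulr_ge0.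
have [delta d0 Hd] := HT _ (divr_gt0 e0 c0).
exists delta => // q qd; have := Hd _ (ex_intro2 _ _ q I erefl) qd => h.
rewrite -[X in X - _]mul1mx -mulmxBl hZ -mulmxA.
apply: (le_trans (mx_norm_mulmx _ _)); rewrite mulrA.
apply: (@le_trans _ _ (c * (eps / c * `|F q - F p|))).
  by apply: ler_pM => //; rewrite ?mulr_ge0 // lerDl.
by rewrite mulrCA_div.
Qed.

End Tangent.

Lemma mx_norm_le_sqrt_sum (R : realType) (n : nat) (v : 'cV[R]_n) :
  `|v| <= Num.sqrt (\sum_i v i 0 ^+ 2).
Proof.
apply: mx_norm_leP => [|i j]; first exact: sqrtr_ge0.
rewrite ord1 -sqrtr_sqr ler_sqrt; last by apply: sumr_ge0 => *; exact: sqr_ge0.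
by rewrite (bigD1 i) //= lerDl; apply: sumr_ge0 => *; exact: sqr_ge0.
Qed.

Lemma mx_norm_sqr_le_sum (R : realType) (n : nat) (v : 'cV[R]_n) :
  `|v| ^+ 2 <= \sum_i v i 0 ^+ 2.
Proof.
have s0 : 0 <= \sum_i v i 0 ^+ 2 by apply: sumr_ge0 => *; exact: sqr_ge0.
by rewrite -[leRHS]sqr_sqrtr // ler_pXn2r ?nnegrE ?sqrtr_ge0 // mx_norm_le_sqrt_sum.
Qed.

Lemma sum_sqr_le_mx_norm (R : realType) (n : nat) (v : 'cV[R]_n) :
  \sum_i v i 0 ^+ 2 <= n%:R * `|v| ^+ 2.
Proof.
rewrite mulr_natl -[X in _ *+ X]card_ord -sumr_const; apply: ler_sum => i _.
by rewrite -(real_normK (num_real _)) ler_pXn2r ?nnegrE // le_mx_norm.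
Qed.

Lemma enorm_le (R : realType) (n : nat) (v : 'cV[R]_n) :
  enorm v <= n.+1%:R * `|v|.
Proof.
rewrite /enorm -[leRHS]ger0_norm ?mulr_ge0 // -sqrtr_sqr ler_sqrt ?sqr_ge0 //.
under eq_bigr do rewrite big_ord1.
apply: (le_trans (sum_sqr_le_mx_norm v)); rewrite exprMn ler_wpM2r ?sqr_ge0 //.
by rewrite -natrX ler_nat expnS expn1 (leq_trans (leqnSn n)) // leq_pmulr.
Qed.

Lemma mulmx_sub_le (R : realType) (m n p : nat) (A A' : 'M[R]_(m, n))
    (B B' : 'M[R]_(n, p)) (a b x y : R) :
  `|A| <= a -> `|B'| <= b -> `|A - A'| <= x -> `|B - B'| <= y ->
  `|A *m B - A' *m B'| <= n%:R * (a * y) + n%:R * (x * b).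
Proof.
move=> Aa Bb AA BB.
have -> : A *m B - A' *m B' = A *m (B - B') + (A - A') *m B'.
  by rewrite mulmxBr mulmxBl addrA subrK.
by apply: (le_trans (ler_normD _ _)); apply: lerD; exact: mx_norm_mulmx_le.
Qed.

(** * A convergence criterion common to both controllers *)

Section Controllers.
Variables (R : realType) (n d : nat) (e : rel 'I_n).
Local Notation conf := 'cV[R]_(n * d).
Local Notation F := (@distmap R n d e).
Variable pstar : conf.

(** Applies the trap to [W = |v|^2]. Convergence is shown for an arbitrary solution, as
    [exp_converges] demands, separately from the existence of one. *)
Lemma controller_converges (X : conf -> conf) (rho C L kappa : R) :
  0 < rho -> 0 <= C -> 0 <= L -> 0 < kappa ->
  (forall p, `|p - pstar| <= rho -> `|X p| <= C * `|F p - F pstar|) ->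
  (forall p q, `|p - pstar| <= rho -> `|q - pstar| <= rho ->
    `|X p - X q| <= L * `|p - q|) ->
  (forall p, `|p - pstar| <= rho ->
    \sum_a (F p - F pstar) a 0 * (rigmx e p *m X p) a 0 <=
    - kappa * \sum_a (F p - F pstar) a 0 ^+ 2) ->
  exists2 delta, 0 < delta & forall p0, `|p0 - pstar| < delta ->
    (exists p : R -> conf, [/\ p 0 = p0, has_velocity p (X \o p) &
      forall t : R, 0 <= t -> `|p t - pstar| <= rho]) /\
    forall p : R -> conf, p 0 = p0 -> has_velocity p (X \o p) ->
    exists q, [/\ `|q - pstar| <= rho, F q = F pstar &
      forall t : R, 0 <= t -> `|q - p t| <= rho * expR (- (2 * kappa) * t)].
Proof.
move=> rho0 C0 L0 kappa0 XC XL Xk.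
pose W (p : conf) := \sum_a (F p - F pstar) a 0 ^+ 2.
have W0 p : 0 <= W p by apply: sumr_ge0 => *; exact: sqr_ge0.
have Wstar : W pstar = 0 by rewrite /W subrr big1 // => a _; rewrite mxE expr0n.
have cW : continuous W.
  move=> p.
  have c1 : {for p, continuous (fun x => F x - F pstar)}.
    apply: (@continuousB _ _ _ F (cst (F pstar)) p).
      exact: distmap_continuous.
    exact: cst_continuous.
  have -> : W = \sum_a (fun x => (F x - F pstar) a 0 ^+ 2).
    by apply/funext => x; rewrite fct_sumE.
  apply: (big_ind (fun g : conf -> R => {for p, continuous g})) => [|f g cf cg|a _].
  - exact: cst_continuous.
  - exact: continuousD.
  have c2 : {for p, continuous (fun x => (F x - F pstar) a 0)}.
    apply: (@continuous_comp _ _ _ (fun x => F x - F pstar) (fun M => M a 0)) => //.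
    exact: coord_continuous.
  exact: (continuousM c2 c2).
(* Since [dF = 2 R], the derivative of [W] is [4 <v, R X>], at most [- 4 kappa W]: the trap is used
   with rate [2 * kappa]. *)
have kappa2 : 0 < 2 * kappa by rewrite mulr_gt0.
have XW p : `|p - pstar| <= rho -> `|X p| <= C * Num.sqrt (W p).
  move=> pr; apply: (le_trans (XC p pr)); rewrite ler_wpM2l //.
  exact: mx_norm_le_sqrt_sum.
have W' (p : R -> conf) t : `|p t - pstar| <= rho -> is_derive t 1 p (X (p t)) ->
    exists2 w, is_derive t 1 (W \o p) w & w <= - (2 * (2 * kappa)) * W (p t).
  move=> pr dp.
  exists (2 * \sum_a (F (p t) - F pstar) a 0 *
      (2 *: (rigmx e (p t) *m X (p t))) a 0).
    apply: (@is_derive_sum_sqr _ _ _ (fun a s => (F (p s) - F pstar) a 0)) => a.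
    apply: (@is_derive_coord _ _ _ _ (fun s => F (p s) - F pstar)).
    rewrite -[X in is_derive _ _ _ X]subr0.
    by apply: (is_deriveB (g := cst (F pstar))); exact: is_derive_distmap.
  under eq_bigr do rewrite [X in _ * X]mxE mulrCA.
  rewrite -mulr_sumr.
  by have := Xk _ pr; rewrite -/(W (p t)); lra.
have [delta d0 H] := exponential_trap rho0 C0 kappa2 Wstar W0 cW XW W'.
exists delta => // p0 p0d; split.
  have [p [pp0 cp dp]] := local_solution_exists rho0 L0 XL p0.
  have cpw : {within `[0, +oo[, continuous p} by exact: continuous_subspaceT.
  rewrite -pp0 in p0d; have [st _] := H p p0d cpw dp.
  exists p; split=> //; split=> // t t0.
  by apply: dp => //; apply: st; exact: ltW.
move=> p pp0 [cp dp]; rewrite -pp0 in p0d.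
have [_ [q [qr Wq qp]]] := H p p0d cp (fun t t0 _ => dp t t0).
exists q; split=> //; apply/eqP; rewrite -subr_eq0 -normr_le0.
by apply: (le_trans (mx_norm_le_sqrt_sum _)); rewrite -/(W q) Wq sqrtr0.
Qed.

(** [chord_tangent] controls the projector at [pstar], whereas the decay needs the one at [p]. The
    chord defect and the difference of the projectors each cost at most [|v| / 4]; together half of
    [|v|] is absorbed, which produces the factor 2. *)
Lemma tangent_proj_locally_bounded : regular_points e pstar ->
  exists2 C, 0 <= C & \forall p \near pstar,
    `|pinv (rigmx e p)| <= C /\
    `|F p - F pstar| <= 2 * `|tangent_proj e p *m (F p - F pstar)|.
Proof.
have absorb (x y : R) : x <= y + (4^-1 * x + 4^-1 * x) -> x <= 2 * y by lra.
move=> reg; have [_ sub rk] := reg.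
have rstar := rk _ (erefl (F pstar)).
have [delta [C [d0 C0 hC]]] := pinv_locally_bounded (rigmx e pstar).
exists C => //.
have [K K0 hK] := pinv_lipschitz #|edges e| (n * d) C0.
rewrite -rstar in sub.
have [//|delta2 d20 tang] := @chord_tangent R n d e pstar (4^-1) sub.
have Cstar : `|pinv (rigmx e pstar)| <= C.
  by apply: (hC _ _).2 => //; rewrite subrr normr0 ltW.
pose a : R := 2 * (`|pstar| + 1).
pose k : R := (n * d)%:R * (a * (K * 2)) + (n * d)%:R * (2 * C).
have k0 : 0 <= k by rewrite addr_ge0 // !mulr_ge0 // addr_ge0.
pose l : R := #|edges e|%:R * k + 1.
have l0 : 0 < l by rewrite ltr_wpDl // mulr_ge0.
near=> p.
have p1 : `|p - pstar| <= 1.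
  by rewrite distrC; near: p; apply: cvgr_dist_le; [exact: cvg_id|].
have pd : `|p - pstar| <= delta / 2.
  by rewrite distrC; near: p; apply: cvgr_dist_le; [exact: cvg_id|exact: divr_gt0].
have pl : `|p - pstar| <= 4^-1 / l.
  by rewrite distrC; near: p; apply: cvgr_dist_le; [exact: cvg_id|exact: divr_gt0].
have rp : regular_points e p by near: p; exact: regular_points_nbhs.
have Fd : `|F p - F pstar| <= delta2.
  rewrite distrC; near: p; apply: cvgr_dist_le => //.
  exact: (@distmap_continuous R n d e pstar).
have RR : `|rigmx e p - rigmx e pstar| <= 2 * `|p - pstar|.
  by rewrite -rigmxB norm_rigmx.
have Cp : `|pinv (rigmx e p)| <= C.
  apply: (hC _ _).2; first by apply: (le_trans RR); lra.
  by rewrite rstar; have [_ _ ->] := rp.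
split=> //.
have Ra : `|rigmx e p| <= a.
  apply: (le_trans (norm_rigmx _ _)); rewrite ler_wpM2l //.
  by rewrite -[p](subrKC pstar) (le_trans (ler_normD _ _)) // lerD2l.
have PP : `|tangent_proj e p - tangent_proj e pstar| <= k * `|p - pstar|.
  apply: (le_trans (mulmx_sub_le Ra Cstar RR
    (le_trans (hK _ _ Cstar Cp) (ler_wpM2l K0 RR)))).
  by rewrite le_eqVlt; apply/orP; left; apply/eqP; rewrite /k; ring.
have := tang p Fd; set v := F p - F pstar => hv.
have hv2 : `|(tangent_proj e p - tangent_proj e pstar) *m v| <= 4^-1 * `|v|.
  apply: (le_trans (mx_norm_mulmx _ _)); rewrite mulrA ler_wpM2r //.
  apply: (@le_trans _ _ (l * (4^-1 / l))); last by rewrite mulrC divfK // gt_eqF.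
  apply: (@le_trans _ _ (l * `|p - pstar|)); last by rewrite ler_pM2l.
  apply: (@le_trans _ _ (#|edges e|%:R * (k * `|p - pstar|))).
    by rewrite ler_wpM2l.
  by rewrite mulrA ler_wpM2r // lerDl.
have : `|v| <= `|tangent_proj e p *m v| + (4^-1 * `|v| + 4^-1 * `|v|).
  rewrite -{1}[v](subrKC (tangent_proj e p *m v)).
  apply: (le_trans (ler_normD _ _)); rewrite lerD2l.
  have -> : v - tangent_proj e p *m v = (v - tangent_proj e pstar *m v) -
      (tangent_proj e p - tangent_proj e pstar) *m v.
    by rewrite mulmxBl opprB addrA subrK.
  by apply: (le_trans (ler_normB _ _)); exact: lerD.
exact: absorb.
Unshelve. all: by end_near. Qed.

End Controllers.

(** * The two controllers *)

Lemma dot_colE (R : realType) (n : nat) (v w : 'cV[R]_n) :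
  \sum_i v i 0 * w i 0 = (v^T *m w) 0 0.
Proof. by rewrite mxE; apply: eq_bigr => i _; rewrite mxE. Qed.

Lemma dot_col_ge (R : realType) (n : nat) (v : 'cV[R]_n) :
  `|v| ^+ 2 <= (v^T *m v) 0 0.
Proof.
rewrite -dot_colE; under eq_bigr do rewrite -expr2.
exact: mx_norm_sqr_le_sum.
Qed.

Section Main.
Variables (R : realType) (n d : nat) (e : rel 'I_n).
Local Notation conf := 'cV[R]_(n * d).
Local Notation F := (@distmap R n d e).
Variable pstar : conf.

Definition model_field (p : conf) : conf :=
  - (2^-1 *: (pinv (rigmx e p) *m (tangent_proj e p *m (F p - F pstar)))).

Definition gradient_field (p : conf) : conf :=
  - ((rigmx e p)^T *m (rigmx e p *m p - F pstar)).

Lemma model_fieldE p :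
  model_field p = - (2^-1 *: (pinv (rigmx e p) *m (F p - F pstar))).
Proof.
have [_ R2 _ _] := @pinvP _ _ _ (rigmx e p).
by rewrite /model_field /tangent_proj !mulmxA R2.
Qed.

Lemma gradient_fieldE p :
  gradient_field p = - ((rigmx e p)^T *m (F p - F pstar)).
Proof. by rewrite /gradient_field -distmap_rigmx. Qed.

(** Here [<v, R X> = - |Pi v|^2 / 2]. The 8 collects this half and the 4 from squaring
    [|v| <= 2 |Pi v|]; the edge count converts the sup norm, shifted by one to stay positive for a
    graph without edges. *)
Lemma model_decay p :
  `|F p - F pstar| <= 2 * `|tangent_proj e p *m (F p - F pstar)| ->
  \sum_a (F p - F pstar) a 0 * (rigmx e p *m model_field p) a 0 <=
  - (8 * #|edges e|.+1%:R)^-1 * \sum_a (F p - F pstar) a 0 ^+ 2.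
Proof.
set v := F p - F pstar => hv; set Pv := tangent_proj e p *m v.
have [] := pinv_projl (rigmx e p); rewrite -/(tangent_proj e p) => T1 I1.
rewrite dot_colE model_fieldE mulmxN -scalemxAr mulmxN -scalemxAr !mulmxA.
have -> : v^T *m rigmx e p *m pinv (rigmx e p) *m v = Pv^T *m Pv.
  rewrite -(mulmxA v^T (rigmx e p)) -/(tangent_proj e p).
  rewrite /Pv trmx_mul T1 mulmxA.
  by rewrite -(mulmxA v^T (tangent_proj e p) (tangent_proj e p)) I1.
rewrite [leLHS]mxE [X in - X <= _]mxE mulNr lerN2.
have h1 := dot_col_ge Pv; set PP := (_ *m _) 0 0 in h1 *.
have h2 := sum_sqr_le_mx_norm v.
have h3 : `|v| ^+ 2 <= 4 * `|Pv| ^+ 2.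
  by have := normr_ge0 v; rewrite -/Pv in hv; nra.
rewrite mulrC ler_pdivrMr ?mulr_gt0 //.
apply: (le_trans h2).
apply: (@le_trans _ _ (#|edges e|.+1%:R * (4 * `|Pv| ^+ 2))).
  by rewrite ler_pM ?sqr_ge0 // ler_nat.
rewrite (_ : 2^-1 * PP * _ = #|edges e|.+1%:R * (4 * PP)); last by field.
by rewrite ler_wpM2l // ler_wpM2l.
Qed.

(** Here [<v, R X> = - |R^T v|^2]. As [Pi] is symmetric, [Pi v = (R^+)^T R^T v], so a bound on the
    pseudoinverse bounds [R^T v] from below. The [+ 1] keeps the denominator positive. *)
Lemma gradient_decay p (C : R) : 0 <= C -> `|pinv (rigmx e p)| <= C ->
  `|F p - F pstar| <= 2 * `|tangent_proj e p *m (F p - F pstar)| ->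
  \sum_a (F p - F pstar) a 0 * (rigmx e p *m gradient_field p) a 0 <=
  - (#|edges e|%:R * (2 * ((n * d)%:R * C)) ^+ 2 + 1)^-1 *
    \sum_a (F p - F pstar) a 0 ^+ 2.
Proof.
move=> C0 pC; set v := F p - F pstar => hv.
have [T1 _] := pinv_projl (rigmx e p).
rewrite dot_colE gradient_fieldE !mulmxN !mulmxA -/v.
set u := (rigmx e p)^T *m v.
have -> : v^T *m rigmx e p *m (rigmx e p)^T *m v = u^T *m u.
  by rewrite /u trmx_mul trmxK !mulmxA.
have hu : `|v| <= 2 * ((n * d)%:R * C) * `|u|.
  apply: (le_trans hv); rewrite -mulrA ler_wpM2l //.
  rewrite /tangent_proj -T1 trmx_mul -mulmxA -/u -mulrA.
  by apply: mx_norm_mulmx_le => //; rewrite mx_norm_tr.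
set g := 2 * _ in hu *.
have g0 : 0 <= g by rewrite !mulr_ge0.
have h1 := dot_col_ge u.
have h2 := sum_sqr_le_mx_norm v.
rewrite [leLHS]mxE mulNr lerN2; apply: (le_trans _ h1).
have k0 : 0 < #|edges e|%:R * g ^+ 2 + 1 by rewrite ltr_wpDl // mulr_ge0 // sqr_ge0.
rewrite mulrC ler_pdivrMr // (le_trans h2) //.
apply: (@le_trans _ _ (#|edges e|%:R * (g * `|u|) ^+ 2)).
  by rewrite ler_wpM2l // ler_pXn2r ?nnegrE ?mulr_ge0.
by rewrite exprMn mulrA mulrC ler_wpM2l ?sqr_ge0 // lerDl.
Qed.

(* Both fields have the form [- c A(p) (F p - F pstar)]. *)
Lemma field_bounds (A : conf -> 'M[R]_(n * d, #|edges e|)) (rho a L : R) :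
  0 < rho -> 0 <= a -> 0 <= L ->
  (forall p, `|p - pstar| <= rho -> `|A p| <= a) ->
  (forall p q, `|p - pstar| <= rho -> `|q - pstar| <= rho ->
     `|A p - A q| <= L * `|p - q|) ->
  exists2 L', 0 <= L' &
    (forall p, `|p - pstar| <= rho -> `|A p *m (F p - F pstar)| <=
       #|edges e|%:R * a * `|F p - F pstar|) /\
    forall p q, `|p - pstar| <= rho -> `|q - pstar| <= rho ->
     `|A p *m (F p - F pstar) - A q *m (F q - F pstar)| <= L' * `|p - q|.
Proof.
move=> rho0 a0 L0 Aa AL.
pose b := (n * d)%:R * (2 * ((`|pstar| + rho) + (`|pstar| + rho))).
have b0 : 0 <= b by rewrite !mulr_ge0 // !addr_ge0 // ltW.
have bd p : `|p - pstar| <= rho -> `|p| <= `|pstar| + rho.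
  by move=> pr; rewrite -[p](subrKC pstar) (le_trans (ler_normD _ _)) // lerD2l.
have FL p q : `|p - pstar| <= rho -> `|q - pstar| <= rho ->
    `|F p - F q| <= b * `|p - q|.
  move=> /bd pr /bd qr; apply: (le_trans (norm_distmap_sub _ _ _)).
  by rewrite mulrA ler_wpM2r // ler_wpM2l // ler_wpM2l // lerD.
have vb p : `|p - pstar| <= rho -> `|F p - F pstar| <= b * rho.
  move=> pr; apply: (le_trans (FL p pstar pr _)); last by rewrite ler_wpM2l.
  by rewrite subrr normr0 ltW.
exists (#|edges e|%:R * (a * b) + #|edges e|%:R * (L * (b * rho))).
  have r0 := ltW rho0.
  by apply: addr_ge0; apply: mulr_ge0 => //; apply: mulr_ge0 => //; exact: mulr_ge0.
split=> [p pr|p q pr qr].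
  by rewrite -mulrA; apply: mx_norm_mulmx_le => //; exact: Aa.
have FF : `|(F p - F pstar) - (F q - F pstar)| <= b * `|p - q|.
  by rewrite opprB addrA subrK; exact: FL.
apply: (le_trans (mulmx_sub_le (Aa p pr) (vb q qr) (AL p q pr qr) FF)).
by rewrite le_eqVlt; apply/orP; left; apply/eqP; ring.
Qed.

(** The return to the Euclidean norm costs the factor [(n * d).+1], which stays positive even when
    [n * d = 0]. *)
Lemma exp_convergesI (sol : conf -> (R -> conf) -> Prop) (U : set conf)
    (rho k : R) :
  0 < rho -> 0 < k ->
  (forall q, `|q - pstar| <= rho -> F q = F pstar -> congruent pstar q) ->
  (forall p0, U p0 -> (exists p, sol p0 p) /\ forall p, sol p0 p ->
     exists q, [/\ `|q - pstar| <= rho, F q = F pstar &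
      forall t : R, 0 <= t -> `|q - p t| <= rho * expR (- k * t)]) ->
  exp_converges sol pstar U.
Proof.
move=> rho0 k0 rig H; exists ((n * d).+1%:R * rho), k; split=> //.
  by rewrite mulr_gt0.
move=> p0 /H[ex all]; split=> // p /all[q [qr Fq qp]].
exists q; first exact: rig.
move=> t t0; apply: (le_trans (enorm_le _)).
by rewrite -mulrA ler_wpM2l // -mulNr qp.
Qed.

(** The equation for [m] is a consequence of that for [p]: with [m = F p], the chain rule gives
    [m' = 2 R p' = - Pi Pi v = - Pi v]. *)
Lemma model_solutionP p0 (p : R -> conf) : p 0 = p0 ->
  (forall t : R, 0 <= t -> regular_points e (p t)) ->
  has_velocity p (model_field \o p) -> model_solution (F pstar) p0 p.
Proof.
move=> pp0 reg [cp dp]; split=> //; exists (F \o p); split=> //; split.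
  apply: (@within_continuous_comp _ _ _ _ p F) => // x _.
  exact: distmap_continuous.
move=> t t0; apply: is_derive_eq (is_derive_distmap e (dp t t0)) _.
have [T1 I1] := pinv_projl (rigmx e (p t)).
rewrite /= /model_field mulmxN -scalemxAr scalerN scalerA divff // scale1r.
by rewrite /tangent_proj !mulmxA -(mulmxA _ (rigmx e (p t)) (pinv _)) I1.
Qed.

Lemma model_solution_velocity p0 (p : R -> conf) :
  model_solution (F pstar) p0 p -> p 0 = p0 /\ has_velocity p (model_field \o p).
Proof.
move=> [pp0 _ [m [mF [cp dp] _]]]; split=> //; split=> // t t0.
by apply: is_derive_eq (dp t t0) _; rewrite mF // ltW.
Qed.

End Main.

Theorem theorem2 (R : realType) (n d : nat) (e : rel 'I_n)
    (e_sym : symmetric e) (e_irr : irreflexive e)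
    (e_rigid : d_rigid R d e)
    (pstar : 'cV[R]_(n * d)) (pstar_reg : regular_points e pstar) :
  (exists U : set 'cV[R]_(n * d),
      [/\ nbhs pstar U,
          exp_converges (model_solution (distmap e pstar)) pstar U &
          exp_converges (gradient_solution (distmap e pstar)) pstar U])
  <-> d_rigid R d e.
Proof.
(* The implication towards [d_rigid] is the standing assumption [e_rigid]; what remains is the
   construction of [U]. *)
split=> // _.
have [C C0 tpb] := tangent_proj_locally_bounded pstar_reg.
have rigid : locally_rigid e pstar.
  apply: e_rigid; have [im sub _] := pstar_reg.
  by split=> //; exists (max_rank R d e).
have : \forall p \near pstar, [/\ `|pinv (rigmx e p)| <= C,
    `|distmap e p - distmap e pstar| <=
      2 * `|tangent_proj e p *m (distmap e p - distmap e pstar)|,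
    regular_points e p &
    distmap e p = distmap e pstar -> congruent pstar p].
  near=> p; have [] : `|pinv (rigmx e p)| <= C /\
      `|distmap e p - distmap e pstar| <=
      2 * `|tangent_proj e p *m (distmap e p - distmap e pstar)|.
    by near: p.
  move=> h1 h2; split => //.
    by near: p; exact: regular_points_nbhs.
  by near: p.
move=> /nbhs_ballP[rho2 /= rho20 near_pstar].
(* Trapping takes place in a closed ball, which has to fit inside the open ball where [near_pstar]
   applies. *)
pose rho := rho2 / 2.
have rho0 : 0 < rho by rewrite divr_gt0.
have loc p : `|p - pstar| <= rho -> [/\ `|pinv (rigmx e p)| <= C,
    `|distmap e p - distmap e pstar| <=
      2 * `|tangent_proj e p *m (distmap e p - distmap e pstar)|,
    regular_points e p &
    distmap e p = distmap e pstar -> congruent pstar p].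
  move=> pr; apply: near_pstar; rewrite -ball_normE /= distrC.
  by apply: (le_lt_trans pr); rewrite /rho; lra.
have [K K0 hK] := pinv_lipschitz #|edges e| (n * d) C0.
have RL p q : `|rigmx e p - rigmx e q| <= 2 * `|p - q|.
  by rewrite -rigmxB norm_rigmx.
have K20 : 0 <= K * 2 by rewrite mulr_ge0.
have pinvC p : `|p - pstar| <= rho -> `|pinv (rigmx e p)| <= C by move=> /loc[].
have pinvL p q : `|p - pstar| <= rho -> `|q - pstar| <= rho ->
    `|pinv (rigmx e p) - pinv (rigmx e q)| <= K * 2 * `|p - q|.
  move=> /pinvC p1 /pinvC q1; apply: (le_trans (hK _ _ q1 p1)).
  by rewrite -mulrA ler_wpM2l ?RL.
have [L1 L10 [M1 M1L]] := field_bounds rho0 C0 K20 pinvC pinvL.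
have a0 : 0 <= 2 * (`|pstar| + rho) by rewrite mulr_ge0 // addr_ge0 // ltW.
have RTC p : `|p - pstar| <= rho -> `|(rigmx e p)^T| <= 2 * (`|pstar| + rho).
  move=> pr; rewrite mx_norm_tr (le_trans (norm_rigmx _ _)) // ler_wpM2l //.
  by rewrite -[p](subrKC pstar) (le_trans (ler_normD _ _)) // lerD2l.
have RTL p q : `|p - pstar| <= rho -> `|q - pstar| <= rho ->
    `|(rigmx e p)^T - (rigmx e q)^T| <= 2 * `|p - q|.
  by move=> _ _; rewrite -linearB /= mx_norm_tr.
have [L2 L20 [M2 M2L]] := field_bounds rho0 a0 (ler0n R 2) RTC RTL.
have half (x y : 'cV[R]_(n * d)) (c : R) : `|x - y| <= c ->
    `|- (2^-1 *: x) - - (2^-1 *: y)| <= c.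
  move=> xy; rewrite -opprD normrN -scalerBr normrZ ger0_norm //.
  by have := normr_ge0 (x - y); lra.
have [delta1 d10 H1] : exists2 delta, 0 < delta &
    forall p0, `|p0 - pstar| < delta ->
    (exists p, model_solution (distmap e pstar) p0 p) /\
    forall p, model_solution (distmap e pstar) p0 p ->
    exists q, [/\ `|q - pstar| <= rho, distmap e q = distmap e pstar &
      forall t : R, 0 <= t -> `|q - p t| <=
        rho * expR (- (2 * (8 * #|edges e|.+1%:R)^-1) * t)].
  have [||p pr|p q pr qr|p pr|delta d0 H] := @controller_converges R n d e pstar
    (model_field e pstar) rho (#|edges e|%:R * C) L1
    (8 * #|edges e|.+1%:R)^-1 rho0 _ L10.
  - by rewrite mulr_ge0.
  - by rewrite invr_gt0 mulr_gt0.
  - rewrite model_fieldE normrN normrZ ger0_norm //.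
    by have := M1 p pr; set x := `|_ *m _|; have := normr_ge0 (pinv (rigmx e p) *m
      (distmap e p - distmap e pstar)); rewrite -/x; lra.
  - by rewrite !model_fieldE; apply: half; exact: M1L.
  - by apply: model_decay; have [] := loc p pr.
  exists delta => // p0 /H[[p [pp0 vp st]] all]; split.
    exists p; apply: model_solutionP => // t t0.
    by have [] := loc _ (st t t0).
  by move=> q /model_solution_velocity[]; exact: all.
have [delta2 d20 H2] : exists2 delta, 0 < delta &
    forall p0, `|p0 - pstar| < delta ->
    (exists p, gradient_solution (distmap e pstar) p0 p) /\
    forall p, gradient_solution (distmap e pstar) p0 p ->
    exists q, [/\ `|q - pstar| <= rho, distmap e q = distmap e pstar &
      forall t : R, 0 <= t -> `|q - p t| <= rho * expR (- (2 *
        (#|edges e|%:R * (2 * ((n * d)%:R * C)) ^+ 2 + 1)^-1) * t)].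
  have [||p pr|p q pr qr|p pr|delta d0 H] := @controller_converges R n d e pstar
    (gradient_field e pstar) rho (#|edges e|%:R * (2 * (`|pstar| + rho))) L2
    (#|edges e|%:R * (2 * ((n * d)%:R * C)) ^+ 2 + 1)^-1 rho0 _ L20.
  - by rewrite mulr_ge0.
  - by rewrite invr_gt0 ltr_wpDl // mulr_ge0 // sqr_ge0.
  - by rewrite gradient_fieldE normrN; exact: M2.
  - by rewrite !gradient_fieldE -opprD normrN; exact: M2L.
  - by apply: gradient_decay => //; have [] := loc p pr.
  exists delta => // p0 /H[[p [pp0 vp st]] all]; split.
    exists p; split=> // t t0.
    by have [] := loc _ (st t t0).
  by move=> q [qp0 _ qv]; exact: all.
exists [set p | `|p - pstar| < Num.min delta1 delta2]; split.
- apply/nbhs_ballP; exists (Num.min delta1 delta2); first by rewrite /= lt_min d10.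
  by move=> p; rewrite -ball_normE /= distrC.
- apply: (exp_convergesI (k := 2 * (8 * #|edges e|.+1%:R)^-1) rho0).
  + by rewrite mulr_gt0 // invr_gt0 mulr_gt0.
  + by move=> q /loc[_ _ _]; exact.
  + by move=> p0 /=; rewrite lt_min => /andP[/H1].
- apply: (exp_convergesI
    (k := 2 * (#|edges e|%:R * (2 * ((n * d)%:R * C)) ^+ 2 + 1)^-1) rho0).
  + by rewrite mulr_gt0 // invr_gt0 ltr_wpDl // mulr_ge0 // sqr_ge0.
  + by move=> q /loc[_ _ _]; exact.
  + by move=> p0 /=; rewrite lt_min => /andP[_ /H2].
Unshelve. all: by end_near. Qed.
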